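(* Let $2\le k\le n-2$. For every $v\in\mathcal H_{k,n}$ there exists a unique noncrossing collection $\mathcal J\in\mathbf{NC}_{k,n}$ such that $v$ lies in the relative interior of the cone $\langle\mathcal J\rangle_+=\{\sum_{J\in\mathcal J}t_Jv_J:t_J\ge0\}$. In particular, the set of cones $\{\langle\mathcal J\rangle_+:\mathcal J\in\mathbf{NC}_{k,n}\}$ is a complete simplicial fan in $\mathcal H_{k,n}$.
   Context: $[n]=\{1,\ldots,n\}$. A $k$-subset of $[n]$ is frozen if it is a cyclic interval $\{j,\ldots,j+k-1\}$ (mod $n$), otherwise nonfrozen. Let $e_{i,j}$, $(i,j)\in[1,k-1]\times[1,n-k]$, be the standard basis of $\mathbb R^{(k-1)\times(n-k)}$ and $\mathcal H_{k,n}=\{\alpha:\sum_{j=1}^{n-k}\alpha_{i,j}=0\ \forall i\}$. Put $f_{i,j}=e_{i,j}-e_{i,j+1}$ ($1\le j\le n-k-1$), $f_{i,n-k}=e_{i,n-k}-e_{i,1}$, $f_{i,[p,q]}=\sum_{t=p}^qf_{i,t}$ (zero if $p>q$), and for $S=\{s_1<\cdots<s_k\}$, $v_S=\sum_{\ell=1}^{k-1}f_{\ell,[s_\ell-(\ell-1),\,s_{\ell+1}-\ell-1]}$. $r$-subsets $A,B$ are weakly separated if there are no $a,b,c,d$ in this cyclic order in $(1,\ldots,n)$ with $a,c\in A\setminus B$, $b,d\in B\setminus A$. $k$-subsets $A=\{a_1<\cdots<a_k\}$, $B=\{b_1<\cdots<b_k\}$ are noncrossing if for each $1\le p<q\le k$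 either $\{a_p,\ldots,a_q\}$, $\{b_p,\ldots,b_q\}$ are weakly separated or $\{a_{p+1},\ldots,a_{q-1}\}\ne\{b_{p+1},\ldots,b_{q-1}\}$. $\mathbf{NC}_{k,n}$ is the set of all (possibly empty) collections of pairwise noncrossing nonfrozen $k$-subsets. *)

(* Defs.v *)
From mathcomp Require Import all_boot all_order all_algebra.
From mathcomp Require Import all_classical all_reals topology normedtype.
Set Implicit Arguments.
Unset Strict Implicit.
Unset Printing Implicit Defensive.
Import Order.TTheory GRing.Theory Num.Theory numFieldNormedType.Exports.

(* Indices are shifted to start at 0: the element a of [n] = {1, .., n} is the
   ordinal of value a - 1 in 'I_n, and similarly for the row index l in
   [1, k-1], the column index t in [1, n-k], and positions in a sorted set. *)

Section Subsets.
Variable n : nat.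
Implicit Types A B S : {set 'I_n}.

(* [enum S] lists S in increasing order. *)
Definition sorted_elt S (l : nat) : nat := nth 0%N (map val (enum S)) l.

Definition segment S (p q : nat) : {set 'I_n} :=
  [set x in S | (p <= index x (enum S) <= q)%N].

Definition frozen (k : nat) S : bool :=
  [exists j : 'I_n,
     S == [set x : 'I_n | [exists i : 'I_k, val x == ((j + i) %% n)%N]]].

Definition cyclic_order (a b c d : 'I_n) : bool :=
  [|| (a < b < c)%N && (c < d)%N, (b < c < d)%N && (d < a)%N,
      (c < d < a)%N && (a < b)%N | (d < a < b)%N && (b < c)%N].

Definition weakly_separated A B : bool :=
  ~~ [exists a : 'I_n, exists b : 'I_n, exists c : 'I_n, exists d : 'I_n,
       [&& cyclic_order a b c d, a \in A :\: B, c \in A :\: B,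
           b \in B :\: A & d \in B :\: A]].

(* For q = p + 1 the inner segments are empty, hence equal. *)
Definition noncrossing (k : nat) A B : bool :=
  [forall p : 'I_k, forall q : 'I_k, (p < q)%N ==>
     (weakly_separated (segment A p q) (segment B p q)
      || (segment A p.+1 q.-1 != segment B p.+1 q.-1))].

Definition NC (k : nat) : {set {set {set 'I_n}}} :=
  [set J : {set {set 'I_n}} |
     [forall A in J, (#|A| == k) && ~~ frozen k A] &&
     [forall A in J, forall B in J, noncrossing k A B]].

End Subsets.

Local Open Scope classical_set_scope.
Local Open Scope ring_scope.

Section Vectors.
Variables (R : realType) (k n : nat).

Definition Hspace : set 'M[R]_(k.-1, n - k) :=
  [set a | forall i, \sum_j a i j = 0].

(* [ordS] is the cyclic successor, so the last column wraps to the first. *)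
Definition fvec (i : 'I_k.-1) (j : 'I_(n - k)) : 'M[R]_(k.-1, n - k) :=
  delta_mx i j - delta_mx i (ordS j).

(* In 1-based notation t ranges over [s_l - (l - 1), s_(l+1) - l - 1]; after
   shifting every index by one this is s_l - l <= t < s_(l+1) - (l + 1).  The
   truncated subtractions are exact because the l-th element is at least l. *)
Definition vvec (S : {set 'I_n}) : 'M[R]_(k.-1, n - k) :=
  \sum_(l < k.-1)
    \sum_(t < n - k | (sorted_elt S l - l <= t < sorted_elt S l.+1 - l.+1)%N)
      fvec l t.

End Vectors.

Section Cones.
Variables (R : realType) (r c : nat).
Local Notation V := 'M[R]_(r, c).

Definition cone (I : finType) (P : {set I}) (g : I -> V) : set V :=
  [set x | exists2 t : I -> R,
     (forall i, i \in P -> 0 <= t i) & x = \sum_(i in P) t i *: g i].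

Definition affine_hull (C : set V) : set V :=
  [set x | exists (m : nat) (g : 'I_m -> V) (t : 'I_m -> R),
     [/\ forall i, C (g i), \sum_i t i = 1 & x = \sum_i t i *: g i]].

Definition relative_interior (C : set V) : set V :=
  [set x | C x /\ \forall y \near x, affine_hull C y -> C y].

Definition polyhedral_cone (C : set V) : Prop :=
  exists (m : nat) (g : 'I_m -> V), C = cone [set: 'I_m]%SET g.

Definition simplicial_cone (C : set V) : Prop :=
  exists (m : nat) (g : m.-tuple V),
    free g /\ C = cone [set: 'I_m]%SET (tnth g).

(* The functional u = 0 is allowed, so a cone is a face of itself. *)
Definition face (F C : set V) : Prop :=
  exists u : {scalar V},
    (forall x, C x -> 0 <= u x) /\ F = C `&` [set x | u x = 0].

Definition fan (Sigma : set (set V)) : Prop :=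
  [/\ finite_set Sigma /\ Sigma !=set0,
      forall C, Sigma C -> polyhedral_cone C,
      forall C F, Sigma C -> face F C -> Sigma F
    & forall C D, Sigma C -> Sigma D -> face (C `&` D) C /\ face (C `&` D) D].

(* The last equation also says that every cone is contained in H. *)
Definition complete_simplicial_fan (H : set V) (Sigma : set (set V)) : Prop :=
  [/\ fan Sigma, forall C, Sigma C -> simplicial_cone C
    & \bigcup_(C in Sigma) C = H].

End Cones.

Definition NCcone (R : realType) (k n : nat) (J : {set {set 'I_n}}) :
  set 'M[R]_(k.-1, n - k) := cone J (@vvec R k n).
Arguments NCcone R k {n} J.

(* Main.v *)
(* Put m = n - k and encode S = {s_0 < ... < s_(k-1)} by the weakly increasing
   word x_l = s_l - l with letters in {0, .., m}.  Row l of v_S is then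
   e_(x_l) - e_(x_(l+1)) with column indices mod m, and A, B fail to be
   noncrossing iff x_p < y_p <= x_q < y_q (or the same with A, B exchanged) for
   some p < q such that the words x, y agree strictly between p and q.

   A nonnegative weight on words has a marginal distribution at each position.
   The key point is that, given marginals increasing in the stochastic order,
   exactly one weight with noncrossing support has these marginals.  It is built
   one letter at a time: sort the prefixes by their last letter, then by the
   previous one, and so on; read each prefix as an opening parenthesis placed
   just before its last letter and each new letter as a closing one.  Extending
   the prefixes without creating a crossing is the same as matching weighted
   parentheses, which can be done in exactly one way.

   Frozen words (constant, or 0..0m..m) cross no word, have v_S = 0, and their
   marginals span the kernel of the passage from marginals to vectors of H.  So
   every v in H lifts to increasing marginals, and two lifts become equal after
   adding frozen words to both: v is a noncrossing combination in exactly one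
   way.  Linear independence, faces, intersections and relative interiors of the
   cones all follow from this uniqueness. *)
From HB Require Import structures.
Require Import Defs.
From mathcomp Require Import all_boot all_order all_algebra.
From mathcomp Require Import all_classical all_reals topology normedtype.
From mathcomp Require Import zify ring lra.
Set Implicit Arguments.
Unset Strict Implicit.
Unset Printing Implicit Defensive.
Import Order.TTheory GRing.Theory Num.Theory numFieldNormedType.Exports.
Local Open Scope ring_scope.

(** * Weighted parenthesis matching *)

Section Matching.
Variables (R : realFieldType) (P : finType) (b : nat) (key last : P -> nat).

(** [nu p y] is the mass of the opening parenthesis [p] closed at [y]. The last clause is nesting:
    an opening [p'] that comes after [p] in the order of [key] and precedes [y] is closed no later
    than [y]. *)
Definition noncrossing_coupling (nu : P -> 'I_b -> R) : Prop :=
  [/\ forall p y, 0 <= nu p y,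
      forall p y, nu p y != 0 -> (last p <= y)%N
    & forall p y p' y', nu p y != 0 -> nu p' y' != 0 ->
        (key p < key p')%N -> (last p' <= y)%N -> (y' <= y)%N].

Lemma sum_eq_exists_gt (I : finType) (f g : I -> R) i0 :
  \sum_i f i = \sum_i g i -> f i0 < g i0 -> exists i, g i < f i.
Proof.
move=> fg lt0; apply/existsP; apply: contraT => /existsPn le_fg.
suff : \sum_i f i < \sum_i g i by rewrite fg ltxx.
rewrite (bigD1 i0) //= [ltRHS](bigD1 i0) //= ltr_leD // ler_sum // => i _.
by rewrite leNgt le_fg.
Qed.

(** Here [y] is the first letter, and [p] the last prefix, at which the couplings differ. Equality
    of the sums over column [y] gives an excess of [nu] at some [(q, y)] with [q] before [p];
    equality over row [p] gives one at some [(p, z)] with [y < z]. These two masses of [nu]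
    cross. *)
Lemma noncrossing_coupling_no_first_diff nu nu' p (y : 'I_b) :
    noncrossing_coupling nu -> noncrossing_coupling nu' ->
    (forall p, \sum_y nu p y = \sum_y nu' p y) ->
    (forall y, \sum_p nu p y = \sum_p nu' p y) ->
    (forall p (z : 'I_b), (z < y)%N -> nu p z = nu' p z) ->
    (forall q, (key p < key q)%N -> nu q y = nu' q y) ->
    injective key -> ~ (nu p y < nu' p y).
Proof.
move=> [nu0 _ nuX] [nu'0 le_last _] eqPs eqY miny maxp key_inj lt_p.
have gt0 q z : nu' q z < nu q z -> nu q z != 0.
  by move=> lt_q; rewrite gt_eqF // (le_lt_trans (nu'0 q z)).
have le_py : (last p <= y)%N.
  by apply: le_last; rewrite gt_eqF // (le_lt_trans (nu0 p y)).
have [q lt_q] := sum_eq_exists_gt (eqY y) lt_p.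
have [z lt_z] := sum_eq_exists_gt (eqPs p) lt_p.
have ltqp : (key q < key p)%N.
  rewrite ltn_neqAle leqNgt; apply/andP; split.
    by apply/eqP => /key_inj eqp; move: lt_q lt_p; rewrite eqp; case: ltgtP.
  by apply/negP => /maxp eq_q; rewrite eq_q ltxx in lt_q.
have ltyz : (y < z)%N.
  rewrite ltn_neqAle leqNgt; apply/andP; split.
    by apply/eqP => /val_inj eqy; move: lt_z lt_p; rewrite -eqy; case: ltgtP.
  by apply/negP => /(miny p) eq_q; rewrite eq_q ltxx in lt_z.
have := nuX q y p z (gt0 _ _ lt_q) (gt0 _ _ lt_z) ltqp le_py.
by rewrite leqNgt ltyz.
Qed.

Lemma noncrossing_coupling_unique nu nu' :
    injective key ->
    noncrossing_coupling nu -> noncrossing_coupling nu' ->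
    (forall p, \sum_y nu p y = \sum_y nu' p y) ->
    (forall y, \sum_p nu p y = \sum_p nu' p y) ->
  forall p y, nu p y = nu' p y.
Proof.
move=> key_inj Hnu Hnu' eqPs eqY p0 y0; apply/eqP; apply: contraT => ne0.
have ney0 : [exists p, nu p y0 != nu' p y0] by apply/existsP; exists p0.
case: (@arg_minnP _ y0 (fun y => [exists p, nu p y != nu' p y]) val ney0) => y.
move=> /existsP[p1 ne1] miny.
case: (@arg_maxnP _ p1 (fun p => nu p y != nu' p y) key ne1) => p nep maxp.
have miny' q (z : 'I_b) : (z < y)%N -> nu q z = nu' q z.
  move=> ltz; apply/eqP; apply: contraT => neq.
  suff /miny : [exists p, nu p z != nu' p z] by rewrite leqNgt ltz.
  by apply/existsP; exists q.
have maxp' q : (key p < key q)%N -> nu q y = nu' q y.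
  by move=> ltq; apply/eqP; apply: contraT => /maxp; rewrite /= leqNgt ltq.
have [lt_p|lt_p|eq_p] := ltgtP (nu p y) (nu' p y).
- case: (noncrossing_coupling_no_first_diff Hnu Hnu' eqPs eqY miny' maxp' _ lt_p).
  exact: key_inj.
- case: (@noncrossing_coupling_no_first_diff nu' nu p y) => //.
  + by move=> q z /miny' ->.
  + by move=> q /maxp' ->.
- by rewrite eq_p eqxx in nep.
Qed.

Lemma sumr_point (I : finType) (Q : pred I) (i0 : I) (w : R) :
  \sum_(i | Q i) (if i == i0 then w else 0) = if Q i0 then w else 0.
Proof.
rewrite -big_mkcondr /=; case: ifP => Q0.
  rewrite (big_pred1 i0) // => i /=.
  by case: eqP => [->|]; rewrite ?Q0 ?andbF.
by rewrite big_pred0 // => i; case: eqP => [->|]; rewrite ?Q0 ?andbF.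
Qed.

Lemma card_support_lt (I : finType) (f f' : I -> R) i0 :
  f i0 != 0 -> f' i0 = 0 -> (forall i, f i = 0 -> f' i = 0) ->
  (#|[pred i | f' i != 0%R]| < #|[pred i | f i != 0%R]|)%N.
Proof.
move=> ne0 eq0 sub; apply: proper_card; apply/properP; split.
  by apply/fintype.subsetP => i; rewrite !inE; apply: contra => /eqP/sub ->.
by exists i0; rewrite !inE ?ne0 ?eq0 ?eqxx.
Qed.

Lemma card_support_le (I : finType) (f f' : I -> R) :
  (forall i, f i = 0 -> f' i = 0) ->
  (#|[pred i | f' i != 0%R]| <= #|[pred i | f i != 0%R]|)%N.
Proof.
move=> sub; apply: subset_leq_card.
by apply/fintype.subsetP => i; rewrite !inE; apply: contra => /eqP/sub ->.
Qed.

(* Greedy parenthesis matching: the first closing point y is matched with the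
   last opening point p before it, using up one of the two. *)
Lemma noncrossing_coupling_exists (al : P -> R) (be : 'I_b -> R) :
    (forall p, 0 <= al p) -> (forall y, 0 <= be y) ->
    \sum_p al p = \sum_y be y ->
    (forall c : nat, \sum_(y : 'I_b | (y <= c)%N) be y <=
               \sum_(p | (last p <= c)%N) al p) ->
  exists nu, [/\ noncrossing_coupling nu, forall p, \sum_y nu p y = al p
    & forall y, \sum_p nu p y = be y].
Proof.
(* Induction on the number of nonzero values of [al] and [be]: each match brings at least one of
   them down to zero. *)
have [N] := ubnP (#|[pred p | al p != 0%R]| + #|[pred y | be y != 0%R]|)%N.
elim: N => // N IHN in al be *; rewrite ltnS => leN al0 be0 tot dom.
have [/existsP[y1 ney1]|/existsPn be_eq0] := boolP [exists y, be y != 0]; last first.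
  have be00 y : be y = 0 by apply/eqP; move: (be_eq0 y); rewrite negbK.
  have sal0 : \sum_p al p = 0 by rewrite tot big1.
  have al00 p : al p = 0.
    by apply: (psumr_eq0P _ sal0) => // q _.
  exists (fun _ _ => 0); split; last 2 first.
  - by move=> p; rewrite big1 ?al00.
  - by move=> p; rewrite big1 ?be00.
  by split=> // [p y|p y p1 y0]; rewrite eqxx.
case: (@arg_minnP _ y1 (fun y => be y != 0) val ney1) => y ney miny.
have be_lt (z : 'I_b) : (z < y)%N -> be z = 0.
  by move=> ltz; apply/eqP; apply: contraT => /miny; rewrite /= leqNgt ltz.
have /existsP[p1 nep1] : [exists p, (last p <= y)%N && (al p != 0)].
  apply: contraT => /existsPn al_eq0.
  have := dom y; rewrite [leRHS]big1; last first.
    by move=> p lep; apply/eqP; have := al_eq0 p; rewrite lep negbK.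
  rewrite leNgt (bigD1 y) //= ltr_pwDl ?lt0r ?ney ?be0 //.
  by apply: sumr_ge0 => z _.
case: (@arg_maxnP _ p1 (fun p => (last p <= y)%N && (al p != 0)) key nep1).
move=> p /andP[lepy nep] maxp.
pose w := Num.min (al p) (be y).
have w_gt0 : 0 < w by rewrite lt_min !lt0r nep ney al0 be0.
have w_al : w <= al p by rewrite ge_min lexx.
have w_be : w <= be y by rewrite ge_min lexx orbT.
pose al' q := al q - (if q == p then w else 0).
pose be' z := be z - (if z == y then w else 0).
have al'0 q : 0 <= al' q.
  by rewrite /al'; case: eqP => [->|_]; rewrite ?subr_ge0 ?subr0.
have be'0 z : 0 <= be' z.
  by rewrite /be'; case: eqP => [->|_]; rewrite ?subr_ge0 ?subr0.
have sub_al q : al q = 0 -> al' q = 0.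
  move=> e; rewrite /al' e; case: eqP => [eqp|_]; rewrite ?subr0 //.
  by move: nep; rewrite -eqp e eqxx.
have sub_be z : be z = 0 -> be' z = 0.
  move=> e; rewrite /be' e; case: eqP => [eqp|_]; rewrite ?subr0 //.
  by move: ney; rewrite -eqp e eqxx.
have [|||nu' [[nu0 nulast nuX] nuP nuY]] := IHN al' be' _ al'0 be'0.
- apply: leq_trans leN; have [le_w|le_w] := leP (al p) (be y).
    rewrite -addSn leq_add ?card_support_le //.
    by apply: (card_support_lt nep) => //; rewrite /al' eqxx /w min_l ?subrr.
  rewrite -addnS leq_add ?card_support_le //.
  by apply: (card_support_lt ney) => //; rewrite /be' eqxx /w min_r ?subrr // ltW.
- by rewrite !sumrB !sumr_point tot.
(* For [y <= c] both sides lose [w], since [last p <= y]; for [c < y] the left side is zero, since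
   [y] is the first closing point with mass. *)
- move=> c; have [leyc|ltcy] := leqP y c.
    by rewrite !sumrB !sumr_point leyc (leq_trans lepy leyc) lerD2r.
  rewrite big1 => [|z lez]; first by apply: sumr_ge0.
  by rewrite sub_be // be_lt // (leq_ltn_trans lez).
have nu'P q z : nu' q z != 0 -> al q != 0.
  apply: contra => /eqP/sub_al al'q.
  by rewrite -(nuP q) in al'q; rewrite (psumr_eq0P _ al'q).
have nu'Y q z : nu' q z != 0 -> be z != 0.
  apply: contra => /eqP/sub_be be'z.
  by rewrite -(nuY z) in be'z; rewrite (psumr_eq0P _ be'z).
exists (fun q z => nu' q z + (if (q == p) && (z == y) then w else 0)).
have nz q z : nu' q z + (if (q == p) && (z == y) then w else 0) != 0 ->
    nu' q z != 0 \/ (q = p /\ z = y).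
  case: ifP => [/andP[/eqP-> /eqP->] _|_]; first by right.
  by rewrite addr0; left.
split; first split.
- by move=> q z; rewrite addr_ge0 //; case: ifP => // _; apply: ltW.
- by move=> q z /nz[/nulast//|[-> ->]].
(* If the new match is the inner one, [y] is the least closing point with mass; if it is the outer
   one, the inner opening contradicts the maximality of [p]. *)
- move=> q z q' z' /nz[nq|[-> ->]] /nz[nq'|[-> ->]] ltq le_last.
  + exact: (nuX q z q' z').
  + exact/(miny z)/(nu'Y q).
  + by have := maxp q'; rewrite le_last (nu'P _ _ nq') /= leqNgt ltq => /(_ isT).
  + by [].
- move=> q; rewrite big_split /= nuP /al'.
  have [->|ne] := eqVneq q p; last by rewrite big1_eq addr0 subr0.
  by rewrite (sumr_point xpredT) /= subrK.
- move=> z; rewrite big_split /= nuY /be'.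
  have [->|ne] := eqVneq z y.
    under [X in _ + X]eq_bigr do rewrite andbT.
    by rewrite (sumr_point xpredT) /= subrK.
  by rewrite big1 ?addr0 ?subr0 // => q _; rewrite andbF.
Qed.

End Matching.

(** * Weights on words *)

Section Words.
Variable b : nat.

Fixpoint word (j : nat) : finType :=
  if j is j'.+1 then (word j' * 'I_b)%type : finType else unit : finType.

(* [letter x i] is 0 for [i] outside of the word. *)
Fixpoint letter j : word j -> nat -> nat :=
  if j is j'.+1 return word j -> nat -> nat then
    fun x i => if i == j' then val x.2 else letter x.1 i
  else fun _ _ => 0%N.

Fixpoint mkword j (f : nat -> 'I_b) : word j :=
  if j is j'.+1 return word j then (mkword j' f, f j') else tt.

(* Comparing keys compares words letter by letter starting from the end. *)
Fixpoint wkey j : word j -> nat :=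
  if j is j'.+1 return word j -> nat then
    fun x => (x.2 * b ^ j' + wkey x.1)%N
  else fun _ => 0%N.

(** For [j' = 0] the last letter of the empty prefix is the default 0, so the first letter is
    free. *)
Fixpoint weakly_incr j : word j -> bool :=
  if j is j'.+1 return word j -> bool then
    fun x => weakly_incr x.1 && (letter x.1 j'.-1 <= x.2)%N
  else fun _ => true.

(** One-sided: only crossings that start with a letter of [x] below that of [y] are excluded. The
    recursive clause copies the nesting clause of [noncrossing_coupling], so that appending a letter
    is literally a coupling problem. *)
Fixpoint uncrossed j : word j -> word j -> bool :=
  if j is j'.+1 return word j -> word j -> bool then
    fun x y => uncrossed x.1 y.1 &&
      ((wkey x.1 < wkey y.1)%N ==> (letter y.1 j'.-1 <= x.2)%N ==>
       (y.2 <= x.2)%N)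
  else fun _ _ => true.

Lemma letter_lt j (x : word j) i : (i < j)%N -> (letter x i < b)%N.
Proof.
elim: j x => //= j IHj x; case: eqP => [_ _|]; first exact: ltn_ord.
by move=> neq lti; apply: IHj; lia.
Qed.

Lemma letter_mkword j f i : (i < j)%N -> letter (mkword j f) i = f i.
Proof.
elim: j => //= j IHj; case: eqP => [->//|neq lti]; apply: IHj; lia.
Qed.

Lemma word_inj j (x y : word j) :
  (forall i, (i < j)%N -> letter x i = letter y i) -> x = y.
Proof.
elim: j x y => [[] []//|j IHj] [x a] [y c] /= eqxy.
rewrite (_ : a = c); last by apply/val_inj; move: (eqxy j); rewrite eqxx; apply.
rewrite (IHj x y) // => i lti; have := eqxy i; rewrite ltn_eqF //; apply; lia.
Qed.

Lemma letterS j (x : word j) (a : 'I_b) i : (i < j)%N ->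
  @letter j.+1 (x, a) i = letter x i.
Proof. by move=> lti /=; rewrite ltn_eqF. Qed.

Lemma letter_last j (x : word j) (a : 'I_b) : @letter j.+1 (x, a) j = a.
Proof. by rewrite /= eqxx. Qed.

Lemma wkey_lt j (x : word j) : (wkey x < b ^ j)%N.
Proof.
elim: j x => //= j IHj [x a] /=; have := IHj x; have := ltn_ord a.
rewrite expnS; nia.
Qed.

Lemma wkey_ltS j (x y : word j) (a c : 'I_b) :
  (@wkey j.+1 (x, a) < @wkey j.+1 (y, c))%N =
  (a < c)%N || (a == c) && (wkey x < wkey y)%N.
Proof.
rewrite /= -(inj_eq val_inj) /=; have := wkey_lt x; have := wkey_lt y.
have [lt_ac|lt_ca|->] := ltngtP (a : nat) c; rewrite /=; [nia|nia|lia].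
Qed.

Lemma wkey_inj j : injective (@wkey j).
Proof.
elim: j => [[] []//|j IHj] [x a] [y c] eqk.
have := wkey_ltS x y a c; have := wkey_ltS y x c a.
rewrite eqk ltnn eq_sym; have [->|/eqP] := eqVneq c a => /=.
  rewrite ltnn /= => /esym/negbT H1 /esym/negbT H2; congr (_, _); apply: IHj.
  lia.
by move=> neq; rewrite !orbF => H1 H2; case: neq; apply/val_inj => /=; lia.
Qed.

Lemma wkey_ltP j (x y : word j) :
  reflect (exists p, [/\ (p < j)%N, (letter x p < letter y p)%N
             & forall r, (p < r < j)%N -> letter x r = letter y r])
          (wkey x < wkey y)%N.
Proof.
apply: (iffP idP).
  elim: j x y => [[] []//|j IHj] [x a] [y c]; rewrite wkey_ltS.
  case/orP => [ltac|/andP[/eqP<- /IHj[p [ltp ltxy eqxy]]]].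
    by exists j; rewrite /= eqxx; split=> // r; lia.
  exists p; rewrite !letterS //; split=> [||r ltr] //=; first by lia.
  by case: eqP => // ner; apply: eqxy; lia.
elim: j x y => [[] [] [p []]//|j IHj [x a] [y c] [p [ltp ltxy eqxy]]].
rewrite wkey_ltS; move: ltxy => /=; case: eqP => [_ -> //|neq ltxy].
apply/orP; right; rewrite (IHj x y) ?andbT.
  by apply/eqP/val_inj; have /= := eqxy j; rewrite eqxx; apply; lia.
exists p; split=> [||r /andP[ltpr ltr]]; [lia|done|].
by have := eqxy r; rewrite !letterS //; apply; lia.
Qed.

Lemma weakly_incrP j (x : word j) :
  reflect (forall i, (i.+1 < j)%N -> (letter x i <= letter x i.+1)%N)
          (weakly_incr x).
Proof.
elim: j x => [x|j IHj [x a]]; first by apply: (iffP idP).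
apply: (iffP andP) => [[/IHj ndx lea] i|ndx].
  rewrite ltnS leq_eqVlt => /orP[/eqP eqj|lti].
    by subst j; rewrite letter_last letterS.
  by rewrite !letterS //; [apply: ndx|lia].
split.
  apply/IHj => i lti; have := ndx i; rewrite !letterS //; [apply; lia|lia].
case: j x ndx {IHj} => // j x /(_ j); rewrite letter_last letterS //.
exact.
Qed.

Lemma weakly_incr_letter j (x : word j) p q :
  weakly_incr x -> (p <= q < j)%N -> (letter x p <= letter x q)%N.
Proof.
move=> /weakly_incrP ndx; elim: q => [|q IHq] /andP[].
  by rewrite leqn0 => /eqP->.
rewrite leq_eqVlt => /orP[/eqP->//|ltpq ltq].
by apply: (leq_trans (IHq _)); [lia|apply: ndx].
Qed.

(** For prefixes of length [q], [wkey x < wkey y] says that [x] is below [y] at the last position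
    [p] where they differ. If [p = q - 1], the recursive and the positional conditions coincide;
    otherwise the words share the letter at [q - 1], and monotonicity puts both the letter of [y] at
    [p] and the one at [q - 1] below the letter of [x] at [q]. *)
Lemma uncrossedP j (x y : word j) : weakly_incr x -> weakly_incr y ->
  reflect (forall p q, (p < q < j)%N ->
             (forall r, (p < r < q)%N -> letter x r = letter y r) ->
             (letter x p < letter y p <= letter x q)%N ->
             (letter y q <= letter x q)%N)
          (uncrossed x y).
Proof.
elim: j x y => [|j IHj].
  by move=> x y _ _; apply: (iffP idP) => // _ p q; rewrite ltn0 andbF.
move=> [x a] [y c] ndx ndy.
have [ndx' lea] := andP ndx; have [ndy' lec] := andP ndy.
apply: (iffP andP) => [[/(IHj x y ndx' ndy') unc /implyP unc'] p q|unc].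
  case/andP => ltpq; rewrite ltnS leq_eqVlt => /orP[/eqP eqq|ltq]; last first.
    have ltp : (p < j)%N by lia.
    rewrite !letterS // => eqr; apply: unc; first by lia.
    by move=> r ltr; have := eqr r ltr; rewrite !letterS //; lia.
  subst q; rewrite !(@letterS _ _ _ p) //= eqxx => eqr /andP[ltp lepa].
  have ltk : (wkey x < wkey y)%N.
    apply/wkey_ltP; exists p; split=> // r ltr; have := eqr r ltr.
    by rewrite !ltn_eqF //; lia.
  apply: (implyP (unc' ltk)) => /=.
  have [->//|nep] := eqVneq j.-1 p.
  have <- // : letter x j.-1 = letter y j.-1.
  by have := eqr j.-1; rewrite ltn_eqF; [apply; lia|lia].
split.
  apply/(IHj x y) => // p q ltpq eqr; have := unc p q.
  have [ltp ltq] : (p < j)%N /\ (q < j)%N by lia.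
  rewrite !letterS //; apply; first by lia.
  by move=> r ltr; rewrite !letterS; [apply: eqr|lia|lia].
apply/implyP => /wkey_ltP[p [ltp ltxy eqr]]; apply/implyP => /= le_last.
have := unc p j; rewrite /= eqxx (ltn_eqF ltp) /=; apply; first by lia.
  by move=> r ltr; rewrite ltn_eqF ?eqr //; lia.
rewrite ltxy (leq_trans _ le_last) //; apply: weakly_incr_letter => //; lia.
Qed.

End Words.

(** * Marginals determine noncrossing weights *)

Section Weights.
Variables (R : realFieldType) (b : nat).

Definition marginal j (t : word b j -> R) (i c : nat) : R :=
  \sum_(x | letter x i == c) t x.

Definition noncrossing_weight j (t : word b j -> R) : Prop :=
  [/\ forall x, 0 <= t x, forall x, t x != 0 -> weakly_incr x
    & forall x y, t x != 0 -> t y != 0 -> uncrossed x y].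

Definition prefix_weight j (t : word b j.+1 -> R) (x : word b j) : R :=
  \sum_y t (x, y).

Lemma sum_prefix_weight j (t : word b j.+1 -> R) (Q : pred (word b j)) :
  \sum_(x | Q x) prefix_weight t x = \sum_(x : word b j.+1 | Q x.1) t x.
Proof.
rewrite pair_big /=; apply: eq_big => [[x y]|[x y] _] //=.
by rewrite andbT.
Qed.

Lemma marginal_prefix j (t : word b j.+1 -> R) i c : (i < j)%N ->
  marginal (prefix_weight t) i c = marginal t i c.
Proof.
move=> lti; rewrite /marginal sum_prefix_weight.
by apply: eq_bigl => -[x y]; rewrite letterS.
Qed.

Lemma marginal_last j (t : word b j.+1 -> R) (y : 'I_b) :
  marginal t j y = \sum_x t (x, y).
Proof.
rewrite /marginal (reindex_onto (fun x => (x, y)) fst) /=.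
  by apply: eq_bigl => x; rewrite !eqxx.
by move=> [x z] /=; rewrite eqxx => /eqP/val_inj->.
Qed.

Lemma prefix_weight_neq0 j (t : word b j.+1 -> R) x :
  prefix_weight t x != 0 -> exists y, t (x, y) != 0.
Proof.
move=> ne; apply/existsP; apply: contraT => /existsPn eq0.
rewrite /prefix_weight big1 ?eqxx // in ne => y _.
by apply/eqP; have := eq0 y; rewrite negbK.
Qed.

Lemma noncrossing_prefix j (t : word b j.+1 -> R) :
  noncrossing_weight t -> noncrossing_weight (prefix_weight t).
Proof.
move=> [t0 tnd tun]; split=> [x|x /prefix_weight_neq0[y /tnd/andP[]]//|x x'].
  exact: sumr_ge0.
by move=> /prefix_weight_neq0[y ty] /prefix_weight_neq0[y' /(tun _ _ ty)/andP[]].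
Qed.

Lemma noncrossing_weight_coupling j (t : word b j.+1 -> R) :
  noncrossing_weight t ->
  noncrossing_coupling (@wkey b j) (fun x => letter x j.-1) (fun x y => t (x, y)).
Proof.
move=> [t0 tnd tun]; split=> // [x y /tnd/andP[]//|x y x' y' ty ty'].
by have /andP[_ /implyP unc] := tun _ _ ty ty' => ltk; apply/implyP/unc.
Qed.

Lemma sum_word0 (s : word b 0 -> R) : \sum_x s x = s tt.
Proof. by rewrite (big_pred1 tt) // => -[]. Qed.

(** Induction on the length: the prefix weights agree and are the row sums of the two couplings that
    append the last letter, while the last marginal gives the column sums. The total mass handles
    the empty word, which has no marginal. *)
Lemma noncrossing_weight_unique j (t t' : word b j -> R) :
    noncrossing_weight t -> noncrossing_weight t' ->
    \sum_x t x = \sum_x t' x ->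
    (forall i c, (i < j)%N -> marginal t i c = marginal t' i c) ->
  t =1 t'.
Proof.
elim: j t t' => [|j IHj] t t' nct nct' tot eqm.
  by case; move: tot; rewrite !sum_word0.
move=> [x y].
refine (noncrossing_coupling_unique (@wkey_inj b j)
  (noncrossing_weight_coupling nct) (noncrossing_weight_coupling nct') _ _ x y).
  apply: (IHj (prefix_weight t) (prefix_weight t')).
  - exact: noncrossing_prefix.
  - exact: noncrossing_prefix.
  - by rewrite !sum_prefix_weight.
  - by move=> i c lti; rewrite !marginal_prefix //; apply: eqm; lia.
by move=> z; rewrite -!marginal_last eqm.
Qed.

Lemma sum_marginal j (t : word b j -> R) i (c : nat) : (i < j)%N ->
  \sum_(y : 'I_b | (y <= c)%N) marginal t i y =
  \sum_(x | (letter x i <= c)%N) t x.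
Proof.
move=> lti; rewrite /marginal.
rewrite (exchange_big_dep (fun x => (letter x i <= c)%N)) /=; last first.
  by move=> y x ley /eqP->.
apply: eq_bigr => x lex; rewrite (big_pred1 (Ordinal (letter_lt x lti))) // => y.
by rewrite /= -(inj_eq val_inj) /= eq_sym; case: eqP => [->|]; rewrite ?lex ?andbF.
Qed.

(** Each step couples the prefix weight [s] with the next marginal. The comparison of cumulative
    sums says that every closing parenthesis finds enough mass opened before it. *)
Lemma noncrossing_weight_exists (mu : nat -> 'I_b -> R) (T : R) j :
    0 <= T ->
    (forall i y, (i < j)%N -> 0 <= mu i y) ->
    (forall i, (i < j)%N -> \sum_y mu i y = T) ->
    (forall i c : nat, (i.+1 < j)%N ->
       \sum_(y : 'I_b | (y <= c)%N) mu i.+1 y <=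
       \sum_(y : 'I_b | (y <= c)%N) mu i y) ->
  exists t : word b j -> R,
    [/\ noncrossing_weight t, \sum_x t x = T
      & forall i (y : 'I_b), (i < j)%N -> marginal t i y = mu i y].
Proof.
move=> T0; elim: j => [|j IHj] mu0 muT mudom.
  exists (fun _ => T); split=> //.
  exact: sum_word0.
have [|||s [[s0 snd sun] sT smu]] := IHj.
- by move=> i y lti; apply: mu0; lia.
- by move=> i lti; apply: muT; lia.
- by move=> i c lti; apply: mudom; lia.
have [//||||nu [[nu0 nulast nuX] nuP nuY]] :=
  @noncrossing_coupling_exists _ _ b (@wkey b j) (fun x => letter x j.-1) s (mu j).
- by move=> y; apply: mu0.
- by rewrite muT.
(* The empty prefix has default last letter 0 and is open from the start, so a partial sum of [mu 0]
   is compared with [T]. For longer prefixes the last letters of [s] are distributed by the previous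
   marginal. *)
- move=> c; case: j {IHj} mu0 muT mudom s s0 snd sun sT smu =>
    [|j] mu0 muT mudom s s0 snd sun sT smu.
    rewrite [leRHS](eq_bigl xpredT) // sT -(muT 0%N) //.
    rewrite [leLHS]big_mkcond ler_sum // => y _.
    by case: ifP => // _; apply: mu0.
  rewrite -(sum_marginal s c (ltnSn j)); apply: le_trans (mudom _ _ _) _ => //.
  by apply: ler_sum => y _; rewrite smu.
have nus x y : nu x y != 0 -> s x != 0.
  apply: contra => /eqP sx0.
  by rewrite -(nuP x) in sx0; rewrite (psumr_eq0P _ sx0).
pose t (x : word b j.+1) := nu x.1 x.2.
have prefix_t x : prefix_weight t x = s x by rewrite -nuP.
exists t; split; first split.
- by move=> [x y]; apply: nu0.
- by move=> [x y] ne; rewrite /= (snd x) ?nulast ?(nus x y).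
- move=> [x y] [x' y'] ne ne' /=; rewrite (sun x x') ?(nus x y) ?(nus x' y') //=.
  by apply/implyP => ltk; apply/implyP => le_last; apply: (nuX x y x' y').
- rewrite -sT -(eq_bigr _ (fun x _ => prefix_t x)).
  by rewrite (sum_prefix_weight t xpredT).
- move=> i y; rewrite ltnS leq_eqVlt => /orP[/eqP->|lti].
    by rewrite marginal_last -nuY.
  rewrite -marginal_prefix // -smu //.
  by apply: eq_bigr => x _.
Qed.

End Weights.

(** * Frozen words *)

Section FrozenWords.
Variables (R : realFieldType) (m k : nat).
Implicit Types x y : word m.+1 k.

Definition constant_word (c : 'I_m.+1) : word m.+1 k := mkword k (fun=> c).

(** The extreme cases [step_word 0] and [step_word k] are the constant words of the letters [m] and
    0. *)
Definition step_word (i : nat) : word m.+1 k :=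
  mkword k (fun l => if (l < i)%N then ord0 else ord_max).

Definition frozen_word x : bool :=
  [exists c, x == constant_word c] || [exists i : 'I_k.+1, x == step_word i].

Lemma frozen_wordP x :
  reflect ((exists2 c, (c <= m)%N & forall l, (l < k)%N -> letter x l = c) \/
           (exists2 i, (i <= k)%N &
              forall l, (l < k)%N -> letter x l = if (l < i)%N then 0%N else m))
          (frozen_word x).
Proof.
apply: (iffP orP) => [[/existsP[c /eqP->]|/existsP[i /eqP->]]|[[c lec xc]|[i lei xi]]].
- by left; exists c; [rewrite -ltnS|move=> l ltl; rewrite letter_mkword].
- right; exists i => [|l ltl]; first by rewrite -ltnS.
  by rewrite letter_mkword //; case: ifP.
- left; apply/existsP; exists (Ordinal (lec : (c < m.+1)%N)).
  by apply/eqP/word_inj => l ltl; rewrite letter_mkword ?xc.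
- right; apply/existsP; exists (Ordinal (lei : (i < k.+1)%N)).
  by apply/eqP/word_inj => l ltl; rewrite letter_mkword ?xi //=; case: ifP.
Qed.

Lemma frozen_word_weakly_incr x : frozen_word x -> weakly_incr x.
Proof.
case/frozen_wordP => [[c _ xc]|[i _ xi]]; apply/weakly_incrP => l ltl.
  by rewrite !xc //; lia.
rewrite !xi; [|lia|lia]; case: ifP => //; case: ifP => //; lia.
Qed.

Lemma frozen_word_uncrossed x y : frozen_word x -> weakly_incr y ->
  uncrossed x y /\ uncrossed y x.
Proof.
move=> frx ndy; have ndx := frozen_word_weakly_incr frx.
split; apply/uncrossedP => // p q ltpq _.
  have ltq : (letter y q < m.+1)%N by apply: letter_lt; lia.
  case/frozen_wordP: frx => [[c _ xc]|[i _ xi]].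
    by rewrite !xc; lia.
  rewrite !xi; [|lia|lia]; case: ifP; case: ifP; lia.
have ltq : (letter y q < m.+1)%N by apply: letter_lt; lia.
case/frozen_wordP: frx => [[c _ xc]|[i _ xi]].
  by rewrite !xc; lia.
rewrite !xi; [|lia|lia]; case: ifP; case: ifP; lia.
Qed.

Lemma marginalD (s t : word m.+1 k -> R) i c :
  marginal (fun x => s x + t x) i c = marginal s i c + marginal t i c.
Proof. exact: big_split. Qed.

Lemma marginalB (s t : word m.+1 k -> R) i c :
  marginal (fun x => s x - t x) i c = marginal s i c - marginal t i c.
Proof. by rewrite /marginal sumrB. Qed.

Lemma marginal_sum (I : finType) (Q : pred I) (s : I -> word m.+1 k -> R) i c :
  marginal (fun x => \sum_(h | Q h) s h x) i c = \sum_(h | Q h) marginal (s h) i c.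
Proof. exact: exchange_big. Qed.

Lemma marginal_point (w : word m.+1 k) (a : R) i c :
  marginal (fun x => if x == w then a else 0) i c =
  if letter w i == c then a else 0.
Proof. exact: sumr_point. Qed.

Lemma marginal_out (t : word m.+1 k -> R) i c :
  (i < k)%N -> (m < c)%N -> marginal t i c = 0.
Proof.
move=> lti ltc; apply: big_pred0 => x.
by apply/eqP => eqc; have := letter_lt x lti; lia.
Qed.

(* The weights of the step words are the successive increments of g _ m. *)
Lemma frozen_word_marginals (g : nat -> nat -> R) :
    (0 < k)%N -> (0 < m)%N ->
    (forall i c, (i < k)%N -> (0 < c < m)%N -> g i c = g 0 c) ->
    (forall i, (i < k)%N -> g i 0 + g i m = g 0 0 + g 0 m) ->
  exists phi : word m.+1 k -> R,
    (forall x, phi x != 0 -> frozen_word x) /\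
    (forall i c, (i < k)%N -> (c <= m)%N -> marginal phi i c = g i c).
Proof.
move=> k0 m0 gmid gends.
(* At position [l] the step words with letter [m] are those of index at most [l], so the partial
   sums of [d] must be [g l m]; the last value of [d] fixes the total. *)
pose d i := if i == 0%N then g 0%N m else
  if (i < k)%N then g i m - g i.-1 m else g 0%N 0%N + g 0%N m - g k.-1 m.
(* The constant words of 0 and [m] are left out of the first sum because they occur as step
   words. *)
pose phi x := \sum_(c : 'I_m.+1 | (0 < c < m)%N)
    (if x == constant_word c then g 0%N c else 0) +
  \sum_(i < k.+1) (if x == step_word i then d i else 0).
have d0 : d 0%N = g 0%N m by [].
have d_in l : (l.+1 < k)%N -> d l.+1 = g l.+1 m - g l m.
  by move=> ltl; rewrite /d ltl.
have d_top : d k = g 0%N 0%N + g 0%N m - g k.-1 m.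
  by rewrite /d gtn_eqF // ltnn.
clearbody d.
have sum_d l : (l < k)%N -> \sum_(i < l.+1) d i = g l m.
  elim: l => [|l IHl] ltl; first by rewrite big_ord_recl big_ord0 addr0 d0.
  by rewrite big_ord_recr IHl 1?ltnW //= d_in // addrC subrK.
have tot_d : \sum_(i < k.+1) d i = g 0%N 0%N + g 0%N m.
  rewrite big_ord_recr /= d_top -[in X in X + _](prednK k0) sum_d ?prednK //.
  by rewrite addrC subrK.
have low_d l : (l < k)%N -> \sum_(i < k.+1 | (i <= l)%N) d i = g l m.
  move=> ltl; rewrite -(sum_d l ltl) (big_ord_widen k.+1 d) //.
  exact: ltnW.
have high_d l : (l < k)%N -> \sum_(i < k.+1 | (l < i)%N) d i = g l 0%N.
  move=> ltl; have := tot_d; rewrite (bigID (fun i : 'I_k.+1 => (i <= l)%N)) /=.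
  rewrite low_d // -(gends l) // addrC => /addIr <-.
  by apply: eq_bigl => i; rewrite -ltnNge.
exists phi; split=> [x|i c lti lec].
  apply: contraR; rewrite negb_or => /andP[/existsPn nc /existsPn ns].
  rewrite /phi !big1 ?addr0 // => [l _|c _]; first by rewrite (negPf (ns l)).
  by rewrite (negPf (nc c)).
rewrite /phi marginalD !marginal_sum.
under eq_bigr do rewrite marginal_point letter_mkword //.
under [X in _ + X]eq_bigr do rewrite marginal_point letter_mkword //.
have sumc : \sum_(c0 : 'I_m.+1 | (0 < c0 < m)%N) (if val c0 == c then g 0%N c0 else 0)
    = if (0 < c < m)%N then g 0%N c else 0.
  rewrite -(sumr_point (fun c0 : 'I_m.+1 => 0 < c0 < m)%N (Ordinal (lec : (c < m.+1)%N))).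
  by apply: eq_bigr => c0 _; rewrite -(inj_eq val_inj) /=; case: eqP => // ->.
rewrite sumc.
have [->|nc0] := eqVneq c 0%N.
  rewrite add0r -high_d // big_mkcond [RHS]big_mkcond /=; apply: eq_bigr => l _.
  by case: (ltnP i l) => _ //=; rewrite gtn_eqF.
have [->|ncm] := eqVneq c m.
  rewrite ltnn andbF add0r -low_d // big_mkcond [RHS]big_mkcond /=.
  apply: eq_bigr => l _.
  by case: (ltnP i l) => _ /=; rewrite ?eqxx // ltn_eqF.
have midc : (0 < c < m)%N by lia.
rewrite midc big1 ?addr0 ?gmid //.
move=> l _; case: (ltnP i l) => _ /=; first by rewrite eq_sym (negPf nc0).
by rewrite eq_sym (negPf ncm).
Qed.

Lemma noncrossing_weight_unique_mod_frozen (t t' : word m.+1 k -> R) :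
    (0 < k)%N -> (0 < m)%N ->
    noncrossing_weight t -> noncrossing_weight t' ->
    (forall i c, (i.+1 < k)%N -> (0 < c < m)%N ->
       marginal t i c - marginal t i.+1 c =
       marginal t' i c - marginal t' i.+1 c) ->
    (forall i, (i.+1 < k)%N ->
       (marginal t i 0 + marginal t i m) -
         (marginal t i.+1 0 + marginal t i.+1 m) =
       (marginal t' i 0 + marginal t' i m) -
         (marginal t' i.+1 0 + marginal t' i.+1 m)) ->
  forall x, ~~ frozen_word x -> t x = t' x.
Proof.
move=> k0 m0 [t0 tnd tun] [t'0 t'nd t'un] mid ends.
pose g i c := marginal t' i c - marginal t i c.
have gmid i c : (i < k)%N -> (0 < c < m)%N -> g i c = g 0%N c.
  move=> lti ltc; elim: i lti => // i IHi lti; rewrite -IHi; last by lia.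
  by have := mid i c lti ltc; rewrite /g; lra.
have gends i : (i < k)%N -> g i 0%N + g i m = g 0%N 0%N + g 0%N m.
  elim: i => // i IHi lti; rewrite -IHi; last by lia.
  by have := ends i lti; rewrite /g; lra.
have [phi [phif phim]] := frozen_word_marginals k0 m0 gmid gends.
pose pos x := Num.max (phi x) 0; pose neg x := Num.max (- phi x) 0.
have pos_neg x : phi x = pos x - neg x.
  by rewrite /pos /neg; case: (leP (phi x) 0); case: (leP (- phi x) 0); lra.
have ncD (s e : word m.+1 k -> R) : noncrossing_weight s -> (forall x, 0 <= e x) ->
    (forall x, e x != 0 -> phi x != 0) -> noncrossing_weight (fun x => s x + e x).
  move=> [s0 snd sun] e0 ephi.
  have supp x : s x + e x != 0 -> s x != 0 \/ frozen_word x.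
    have [->|] := eqVneq (s x) 0; last by left.
    by rewrite add0r => /ephi/phif; right.
  split=> [x|x|x y]; first exact: addr_ge0.
    by move=> /supp[/snd//|]; apply: frozen_word_weakly_incr.
  move=> /supp[sx|fx] /supp[sy|fy]; first exact: sun.
  - by case: (frozen_word_uncrossed fy (snd _ sx)).
  - by case: (frozen_word_uncrossed fx (snd _ sy)).
  - by case: (frozen_word_uncrossed fx (frozen_word_weakly_incr fy)).
have tt' : (fun x => t x + pos x) =1 (fun x => t' x + neg x).
  have nct : noncrossing_weight (fun x => t x + pos x).
    apply: ncD => // x; first by rewrite le_max lexx orbT.
    by apply: contra => /eqP eq0; rewrite /pos eq0 maxxx.
  have nct' : noncrossing_weight (fun x => t' x + neg x).
    apply: ncD => // x; first by rewrite le_max lexx orbT.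
    by apply: contra => /eqP eq0; rewrite /neg eq0 oppr0 maxxx.
  have eqm i c : (i < k)%N ->
      marginal (fun x => t x + pos x) i c = marginal (fun x => t' x + neg x) i c.
    move=> lti; have [lec|ltc] := leqP c m; last by rewrite !marginal_out.
    rewrite !marginalD; have := phim i c lti lec.
    have -> : marginal phi i c = marginal (fun x => pos x - neg x) i c.
      by apply: eq_bigr => x _.
    by rewrite marginalB /g; lra.
  apply: noncrossing_weight_unique => //.
  have total (s : word m.+1 k -> R) : \sum_x s x = \sum_(y : 'I_m.+1) marginal s 0 y.
    have := sum_marginal s m k0.
    rewrite (eq_bigl xpredT) => [->|y]; last by rewrite -ltnS ltn_ord.
    by apply: eq_bigl => x; rewrite -ltnS letter_lt.
  by rewrite !total; apply: eq_bigr => y _; apply: eqm.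
move=> x nfx; have := tt' x.
have phi0 : phi x = 0 by apply/eqP; apply: contraR nfx => /phif.
by rewrite /pos /neg phi0 oppr0 maxxx !addr0.
Qed.

End FrozenWords.

(** * Subsets as words *)

Section SetsAndWords.
Local Open Scope nat_scope.
Variables (n k : nat).
Implicit Types A B S : {set 'I_n}.

Lemma sorted_val_enum S : sorted ltn (map val (enum S)).
Proof.
apply: (subseq_sorted ltn_trans _ (iota_ltn_sorted 0 n)).
by rewrite -val_enum_ord map_subseq // enumT filter_subseq.
Qed.

Lemma size_val_enum S : size (map val (enum S)) = #|S|.
Proof. by rewrite size_map -cardE. Qed.

Lemma sorted_elt_lt S p q : p < q < #|S| -> sorted_elt S p < sorted_elt S q.
Proof.
move=> /andP[ltpq ltq]; rewrite /sorted_elt.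
apply: (sorted_ltn_nth ltn_trans) => //; rewrite ?inE ?size_val_enum //.
  exact: sorted_val_enum.
exact: ltn_trans ltq.
Qed.

Lemma sorted_elt_index S (x : 'I_n) : x \in S ->
  sorted_elt S (index x (enum S)) = x.
Proof.
move=> xS; rewrite /sorted_elt (nth_map x) ?nth_index ?mem_enum //.
by rewrite index_mem mem_enum.
Qed.

Lemma sorted_eltP S r : r < #|S| ->
  exists x : 'I_n, [/\ x \in S, index x (enum S) = r & sorted_elt S r = x].
Proof.
move=> ltr; have ltr' : r < size (enum S) by rewrite -cardE.
case E : (enum S) => [|x0 s]; first by rewrite E in ltr'.
exists (nth x0 (enum S) r); split.
- by rewrite -mem_enum mem_nth.
- by rewrite -E index_uniq ?enum_uniq.
- by rewrite /sorted_elt (nth_map x0).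
Qed.

Lemma index_enum_lt S (x : 'I_n) : x \in S -> index x (enum S) < #|S|.
Proof. by move=> xS; rewrite cardE index_mem mem_enum. Qed.

Lemma mem_sorted_elt S (x : 'I_n) :
  reflect (exists2 r, r < #|S| & val x = sorted_elt S r) (x \in S).
Proof.
apply: (iffP idP) => [xS|[r /sorted_eltP[y [yS _ ->]] /val_inj->]] //.
by exists (index x (enum S)); rewrite ?index_enum_lt ?sorted_elt_index.
Qed.

Lemma segmentP S p q (x : 'I_n) : q < #|S| ->
  reflect (exists2 r, p <= r <= q & val x = sorted_elt S r) (x \in segment S p q).
Proof.
move=> ltq; rewrite inE; apply: (iffP andP) => [[xS lex]|[r ler eqx]].
  by exists (index x (enum S)); rewrite // sorted_elt_index.
have [|y [yS eqr eqy]] := @sorted_eltP S r; first by lia.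
have -> : x = y by apply/val_inj; rewrite eqx.
by rewrite eqr.
Qed.

(** [inord] is exact on [k]-subsets, where [sorted_elt_bounds] places the argument between 0 and
    [n - k]. *)
Definition code S : word (n - k).+1 k :=
  mkword k (fun l => inord (sorted_elt S l - l)).

Definition decode (w : word (n - k).+1 k) : {set 'I_n} :=
  [set x : 'I_n | [exists l : 'I_k, val x == letter w l + l]].

Lemma sorted_elt_bounds S l : #|S| = k -> l < k ->
  l <= sorted_elt S l <= n - k + l.
Proof.
move=> Sk ltl; apply/andP; split.
  elim: l ltl => // l IHl ltl; have := @sorted_elt_lt S l l.+1.
  by rewrite Sk ltl ltnSn => /(_ isT); have := IHl (ltnW ltl); lia.
have lt_n r : r < k -> sorted_elt S r < n.
  by rewrite -Sk => /sorted_eltP[x [_ _ ->]].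
have step d : l + d < k -> sorted_elt S l + d <= sorted_elt S (l + d).
  elim: d => [|d IHd] ltd; first by rewrite !addn0.
  have := @sorted_elt_lt S (l + d) (l + d.+1); rewrite Sk ltd andbT addnS ltnSn.
  by move=> /(_ isT); have := IHd; lia.
have := step (k.-1 - l); have := lt_n k.-1.
rewrite (_ : l + (k.-1 - l) = k.-1); lia.
Qed.

Lemma letter_code S l : #|S| = k -> l < k -> letter (code S) l = sorted_elt S l - l.
Proof.
move=> Sk ltl; rewrite letter_mkword // inordK //.
by have := sorted_elt_bounds Sk ltl; lia.
Qed.

Lemma sorted_elt_code S l : #|S| = k -> l < k -> sorted_elt S l = letter (code S) l + l.
Proof.
by move=> Sk ltl; rewrite letter_code //; have := sorted_elt_bounds Sk ltl; lia.
Qed.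

Lemma code_weakly_incr S : #|S| = k -> weakly_incr (code S).
Proof.
move=> Sk; apply/weakly_incrP => l ltl; rewrite !letter_code //; last exact: ltnW.
have := @sorted_elt_lt S l l.+1; rewrite Sk ltl ltnSn => /(_ isT).
by have := sorted_elt_bounds Sk (ltnW ltl); lia.
Qed.

Lemma codeK S : #|S| = k -> decode (code S) = S.
Proof.
move=> Sk; apply/setP => x; rewrite inE; apply/existsP/mem_sorted_elt.
  move=> [l /eqP ->]; exists (val l); first by rewrite Sk ltn_ord.
  by rewrite sorted_elt_code ?ltn_ord.
move=> [l ltl eqx]; rewrite Sk in ltl; exists (Ordinal ltl).
by rewrite eqx sorted_elt_code.
Qed.

Lemma val_enum_decode (w : word (n - k).+1 k) : k <= n -> weakly_incr w ->
  map val (enum (decode w)) = [seq letter w l + l | l <- iota 0 k].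
Proof.
move=> lekn iw; apply: (irr_sorted_eq ltn_trans ltnn).
- exact: sorted_val_enum.
- apply/(sortedP 0) => l; rewrite size_map size_iota => ltl.
  rewrite !(nth_map 0) ?size_iota ?(ltnW ltl) // !nth_iota ?(ltnW ltl) // !add0n.
  by have := weakly_incrP _ iw _ ltl; lia.
- move=> i; apply/mapP/mapP => [[x]|[l]].
    rewrite mem_enum inE => /existsP[l /eqP eqx] ->.
    by exists (val l); rewrite // mem_iota ltn_ord.
  rewrite mem_iota /= add0n => ltl ->.
  have ltn' : letter w l + l < n by have := letter_lt w ltl; lia.
  exists (Ordinal ltn') => //; rewrite mem_enum inE; apply/existsP.
  by exists (Ordinal ltl).
Qed.

Lemma card_decode w : k <= n -> weakly_incr w -> #|decode w| = k.
Proof.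
by move=> lekn iw; rewrite -size_val_enum val_enum_decode // size_map size_iota.
Qed.

Lemma decodeK w : k <= n -> weakly_incr w -> code (decode w) = w.
Proof.
move=> lekn iw; apply: word_inj => l ltl.
rewrite letter_code ?card_decode // /sorted_elt val_enum_decode //.
by rewrite (nth_map 0) ?size_iota // nth_iota // add0n addnK.
Qed.

(** Strong induction with [a r = c s] and [c r = a s']: [s < r] or [s' < r] contradicts the
    induction hypothesis, and if both exceed [r] then [a r = c s > c r = a s' > a r]. *)
Lemma strictly_incr_image_eq (a c : nat -> nat) p q :
    (forall r s, p < r -> r < s -> s < q -> a r < a s) ->
    (forall r s, p < r -> r < s -> s < q -> c r < c s) ->
    (forall r, p < r < q -> exists2 s, p < s < q & a r = c s) ->
    (forall r, p < r < q -> exists2 s, p < s < q & c r = a s) ->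
  forall r, p < r < q -> a r = c r.
Proof.
move=> inca incc ac ca; elim/ltn_ind => r IHr ltr.
have [s lts eqs] := ac r ltr; have [s' lts' eqs'] := ca r ltr.
have [ltsr|ltrs|eqsr] := ltngtP s r; last by rewrite eqs eqsr.
  have := IHr s ltsr lts; have := inca s r; lia.
have [ltsr'|ltrs'|eqsr'] := ltngtP s' r; last by rewrite eqs' eqsr'.
  have := IHr s' ltsr' lts'; have := incc s' r; lia.
have := inca r s'; have := incc r s; lia.
Qed.

Lemma inner_segment_eq A B p q : #|A| = k -> #|B| = k -> p < q < k ->
  reflect (forall r, p < r < q -> sorted_elt A r = sorted_elt B r)
          (segment A p.+1 q.-1 == segment B p.+1 q.-1).
Proof.
move=> Ak Bk ltpq.
have memS S r : #|S| = k -> p < r < q ->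
    exists2 x : 'I_n, x \in segment S p.+1 q.-1 & sorted_elt S r = x.
  move=> Sk ltr; have [|x [_ _ eqx]] := @sorted_eltP S r; first by lia.
  by exists x => //; apply/segmentP; [lia|exists r => //; lia].
have incr S r s : #|S| = k -> p < r -> r < s -> s < q ->
    sorted_elt S r < sorted_elt S s.
  by move=> Sk *; apply: sorted_elt_lt; lia.
apply: (iffP eqP) => [eqAB|eqAB].
  apply: strictly_incr_image_eq.
  - by move=> r s; apply: incr.
  - by move=> r s; apply: incr.
  - move=> r ltr; have [x + ->] := memS A r Ak ltr.
    rewrite eqAB => /segmentP[|s les ->]; first by lia.
    by exists s => //; lia.
  - move=> r ltr; have [x + ->] := memS B r Bk ltr.
    rewrite -eqAB => /segmentP[|s les ->]; first by lia.
    by exists s => //; lia.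
apply/setP => x; apply/segmentP/segmentP; [lia|lia| |].
  by move=> [r ler ->]; exists r => //; apply: eqAB; lia.
by move=> [r ler ->]; exists r => //; apply/esym/eqAB; lia.
Qed.

Definition crossing_at A B p q : bool :=
  [&& sorted_elt A p < sorted_elt B p, sorted_elt B p < sorted_elt A q
    & sorted_elt A q < sorted_elt B q].

(** The witnesses are the four end elements. Each lies in one segment only, because the other
    segment consists of its own two ends and of the common inner elements. *)
Lemma crossing_at_not_separated A B p q :
    #|A| = k -> #|B| = k -> p < q < k ->
    (forall r, p < r < q -> sorted_elt A r = sorted_elt B r) ->
    crossing_at A B p q ->
  exists a b c d : 'I_n,
    [/\ cyclic_order a b c d,
        a \in segment A p q :\: segment B p q, c \in segment A p q :\: segment B p q,
        b \in segment B p q :\: segment A p q & d \in segment B p q :\: segment A p q].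
Proof.
move=> Ak Bk ltpq inner /and3P[lt1 lt2 lt3].
have [|a [_ _ eqa]] := @sorted_eltP A p; first by lia.
have [|b [_ _ eqb]] := @sorted_eltP B p; first by lia.
have [|c [_ _ eqc]] := @sorted_eltP A q; first by lia.
have [|d [_ _ eqd]] := @sorted_eltP B q; first by lia.
have ltA r s : r < s <= q -> sorted_elt A r < sorted_elt A s.
  by move=> *; apply: sorted_elt_lt; lia.
have ltB r s : r < s <= q -> sorted_elt B r < sorted_elt B s.
  by move=> *; apply: sorted_elt_lt; lia.
have rng r : p <= r <= q -> [\/ r = p, r = q | p < r < q].
  have [->|nep] := eqVneq r p; first by constructor 1.
  have [->|neq] := eqVneq r q; first by constructor 2.
  by constructor 3; lia.
have inA r (x : 'I_n) : p <= r <= q -> sorted_elt A r = x -> x \in segment A p q.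
  by move=> ler eqx; apply/segmentP; [lia|exists r].
have inB r (x : 'I_n) : p <= r <= q -> sorted_elt B r = x -> x \in segment B p q.
  by move=> ler eqx; apply/segmentP; [lia|exists r].
have outA (x : 'I_n) : (forall r, p <= r <= q -> sorted_elt A r <> x) ->
    x \notin segment A p q.
  move=> neA; apply/negP => /segmentP[|r ler eqx]; [lia|exact: (neA r ler (esym eqx))].
have outB (x : 'I_n) : (forall r, p <= r <= q -> sorted_elt B r <> x) ->
    x \notin segment B p q.
  move=> neB; apply/negP => /segmentP[|r ler eqx]; [lia|exact: (neB r ler (esym eqx))].
exists a, b, c, d; split.
- by rewrite /cyclic_order -eqa -eqb -eqc -eqd lt1 lt2 lt3.
- rewrite finset.in_setD (inA p) // ?andbT; last by lia.
  apply: outB => r /rng[->|->|ltr]; [lia|have := ltB p q; lia|have := ltB p r; lia].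
- rewrite finset.in_setD (inA q) // ?andbT; last by lia.
  apply: outB => r /rng[->|->|ltr]; [lia|lia|].
  by rewrite -inner //; have := ltA r q; lia.
- rewrite finset.in_setD (inB p) // ?andbT; last by lia.
  apply: outA => r /rng[->|->|ltr]; [lia|lia|].
  by rewrite inner //; have := ltB p r; lia.
- rewrite finset.in_setD (inB q) // ?andbT; last by lia.
  apply: outA => r /rng[->|->|ltr]; [lia|lia|].
  by have := ltA r q; lia.
Qed.

Lemma weakly_separatedC A B : weakly_separated A B = weakly_separated B A.
Proof.
congr (~~ _); apply/idP/idP; do 4!move/existsP=> [?];
  move=> /and5P[cyc inA inA' inB inB'].
all: move: cyc inA inA' inB inB'; set a := (X in cyclic_order X);
  set b := (X in cyclic_order _ X); set c := (X in cyclic_order _ _ X);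
  set d := (X in cyclic_order _ _ _ X) => cyc ina inc inb ind.
(* Rotating the cyclic quadruple by one place exchanges the roles of the two sets. *)
all: apply/existsP; exists b; apply/existsP; exists c;
  apply/existsP; exists d; apply/existsP; exists a.
all: rewrite ina inb inc ind !andbT; move: cyc; rewrite /cyclic_order; lia.
Qed.

(** Once the inner elements agree, the differences of the segments contain end elements only, so a
    violating quadruple is made of the four ends, alternating in one of two ways. *)
Lemma segment_weakly_separated A B p q :
    #|A| = k -> #|B| = k -> p < q < k ->
    (forall r, p < r < q -> sorted_elt A r = sorted_elt B r) ->
  weakly_separated (segment A p q) (segment B p q) =
    ~~ crossing_at A B p q && ~~ crossing_at B A p q.
Proof.
move=> Ak Bk ltpq inner; rewrite -negb_or; congr (~~ _); apply/idP/idP; last first.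
  have inner' r : p < r < q -> sorted_elt B r = sorted_elt A r by move=> /inner.
  suff cr (C D : {set 'I_n}) : #|C| = k -> #|D| = k ->
      (forall r, p < r < q -> sorted_elt C r = sorted_elt D r) ->
      crossing_at C D p q -> ~~ weakly_separated (segment C p q) (segment D p q).
    case/orP => /cr; first by move=> /(_ Ak Bk inner); rewrite negbK.
    by move=> /(_ Bk Ak inner'); rewrite weakly_separatedC negbK.
  move=> Ck Dk innerCD crCD; rewrite negbK.
  have [a [b [c [d [cyc ina inc inb ind]]]]] :=
    crossing_at_not_separated Ck Dk ltpq innerCD crCD.
  apply/existsP; exists a; apply/existsP; exists b; apply/existsP; exists c.
  by apply/existsP; exists d; apply/and5P.
have ends (C D : {set 'I_n}) (x : 'I_n) : #|C| = k -> #|D| = k ->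
    (forall r, p < r < q -> sorted_elt C r = sorted_elt D r) ->
    x \in segment C p q :\: segment D p q ->
    x = sorted_elt C p :> nat \/ x = sorted_elt C q :> nat.
  move=> Ck Dk innerCD /finset.setDP[/segmentP[|r ler eqx]]; first by lia.
  have [<- _|nep] := eqVneq r p; first by left.
  have [<- _|neq] := eqVneq r q; first by right.
  case/negP; apply/segmentP; [lia|exists r => //].
  by rewrite -innerCD //; lia.
have inner' r : p < r < q -> sorted_elt B r = sorted_elt A r by move=> /inner.
have ltA := @sorted_elt_lt A p q; have ltB := @sorted_elt_lt B p q.
do 4!move/existsP=> [?]; move=> /and5P[cyc].
move=> /(ends A B _ Ak Bk inner) ea /(ends A B _ Ak Bk inner) ec.
move=> /(ends B A _ Bk Ak inner') eb /(ends B A _ Bk Ak inner') ed.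
move: cyc ea eb ec ed; rewrite /cyclic_order /crossing_at /=; lia.
Qed.

(** Passing to letters subtracts the position, so a strict inequality between an element at [p] and
    one at [q = p + 1] becomes a weak one between letters. For larger [q] the common letter at
    [q - 1] makes both forms true. *)
Lemma noncrossing_code A B : #|A| = k -> #|B| = k ->
  noncrossing k A B =
  uncrossed (code A) (code B) && uncrossed (code B) (code A).
Proof.
move=> Ak Bk; have iA := code_weakly_incr Ak; have iB := code_weakly_incr Bk.
have letters r : r < k -> (letter (code A) r == letter (code B) r) =
    (sorted_elt A r == sorted_elt B r).
  by move=> ltr; rewrite !sorted_elt_code // eqn_add2r.
apply/idP/andP => [nc|[/uncrossedP ncAB /uncrossedP ncBA]].
  have nopq p q : p < q < k ->
      (forall r, p < r < q -> sorted_elt A r = sorted_elt B r) ->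
      ~~ crossing_at A B p q && ~~ crossing_at B A p q.
    move=> ltpq inner; rewrite -segment_weakly_separated //.
    have ltp : p < k by lia.
    have ltq : q < k by lia.
    have /forallP/(_ (Ordinal ltp))/forallP/(_ (Ordinal ltq)) := nc.
    rewrite /= (andP ltpq).1 /= => /orP[//|].
    by move/inner_segment_eq: inner => -> //.
  split; apply/uncrossedP => // p q ltpq inner.
    have := nopq p q ltpq; rewrite /crossing_at !sorted_elt_code //; [|lia..].
    move=> h lts; apply: contraTT isT => nle.
    have /h : forall r, p < r < q -> sorted_elt A r = sorted_elt B r.
      by move=> r ltr; apply/eqP; rewrite -letters ?inner //; lia.
    by lia.
  have := nopq p q ltpq; rewrite /crossing_at !sorted_elt_code //; [|lia..].
  move=> h lts; apply: contraTT isT => nle.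
  have /h : forall r, p < r < q -> sorted_elt A r = sorted_elt B r.
    by move=> r ltr; apply/eqP; rewrite -letters -?inner //; lia.
  by lia.
apply/forallP => p; apply/forallP => q; apply/implyP => ltpq.
have ltpqk : p < q < k by rewrite ltpq ltn_ord.
have [/inner_segment_eq inner|] := boolP (segment A p.+1 q.-1 == segment B p.+1 q.-1);
  last by rewrite orbT.
have {}inner := inner Ak Bk ltpqk.
rewrite orbF segment_weakly_separated //.
have innerL r : p < r < q -> letter (code A) r = letter (code B) r.
  by move=> ltr; apply/eqP; rewrite letters ?inner //; lia.
have innerR r : p < r < q -> letter (code B) r = letter (code A) r.
  by move=> /innerL.
have := ncAB iA iB p q ltpqk innerL; have := ncBA iB iA p q ltpqk innerR.
have inA : p.+1 < q -> letter (code A) p <= letter (code B) q.-1 <= letter (code B) q /\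
                       letter (code B) p <= letter (code B) q.-1 <= letter (code A) q.
  move=> ltq; have inq := @innerL q.-1.
  have := @weakly_incr_letter _ _ (code A) p q.-1 iA.
  have := @weakly_incr_letter _ _ (code A) q.-1 q iA.
  have := @weakly_incr_letter _ _ (code B) p q.-1 iB.
  have := @weakly_incr_letter _ _ (code B) q.-1 q iB.
  by rewrite inq; lia.
rewrite /crossing_at !sorted_elt_code //; lia.
Qed.

End SetsAndWords.

(** * Noncrossing combinations *)

Section FrozenSets.
Local Open Scope nat_scope.
Variables (n k : nat).
Implicit Types S : {set 'I_n}.
Hypotheses (k_gt0 : 0 < k) (le_kn : k <= n).

Definition cyclic_interval (j : 'I_n) : {set 'I_n} :=
  [set x : 'I_n | [exists i : 'I_k, val x == (j + i) %% n]].

Lemma decode_constant (w : word (n - k).+1 k) (j : 'I_n) :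
  j <= n - k -> (forall l, l < k -> letter w l = j) -> decode w = cyclic_interval j.
Proof.
move=> lej wj; have small (l : 'I_k) : (j + l) %% n = j + l.
  by have ltl := ltn_ord l; rewrite modn_small //; lia.
by apply/setP => x; rewrite !inE; apply/existsP/existsP => -[l /eqP ->];
  exists l; rewrite small wj ?ltn_ord.
Qed.

(** The interval starting at [n - k + i] takes the top [k - i] elements and wraps around to the [i]
    smallest ones; these come first in increasing order, whence the initial zeros of the word. *)
Lemma decode_step (w : word (n - k).+1 k) (i : nat) (j : 'I_n) :
    i < k -> j = n - k + i :> nat ->
    (forall l, l < k -> letter w l = if l < i then 0 else n - k) ->
  decode w = cyclic_interval j.
Proof.
move=> lti eqj wi; apply/setP => x; rewrite !inE.
apply/existsP/existsP => -[l /eqP ->]; have ltl := ltn_ord l.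
  rewrite wi //; case: ltnP => leli.
    have ltr : l + k - i < k by lia.
    exists (Ordinal ltr) => /=; rewrite eqj.
    rewrite (_ : n - k + i + (l + k - i) = n + l); last by lia.
    by rewrite modnDl modn_small //; lia.
  have ltr : l - i < k by lia.
  exists (Ordinal ltr) => /=; rewrite eqj.
  by rewrite modn_small; [apply/eqP|]; lia.
rewrite eqj; have [ltil|leki] := ltnP (i + l) k.
  exists (Ordinal ltil) => /=; rewrite wi // ltnNge leq_addr /=.
  by rewrite modn_small; [apply/eqP|]; lia.
have ltr : i + l - k < k by lia.
exists (Ordinal ltr) => /=; rewrite wi // (_ : i + l - k < i); last by lia.
rewrite (_ : n - k + i + l = n + (i + l - k)); last by lia.
by rewrite modnDl modn_small //; lia.
Qed.

Lemma frozen_code S : #|S| = k -> frozen k S = frozen_word (code k S).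
Proof.
move=> Sk; apply/existsP/idP => [[j /eqP eqS]|/frozen_wordP frS]; last first.
  rewrite -(codeK Sk); case: frS => [[c lec wc]|[i]].
    have ltc : c < n by lia.
    exists (Ordinal ltc); apply/eqP; exact: (@decode_constant _ (Ordinal ltc)).
  (* For [i = k] the step word is the constant 0, coding the interval that starts at 0. *)
  rewrite leq_eqVlt => /orP[/eqP-> wi|lti wi].
    have lt0 : 0 < n by lia.
    exists (Ordinal lt0); apply/eqP; apply: (@decode_constant _ (Ordinal lt0)) => //.
    by move=> l ltl; rewrite wi ?ltl.
  have ltj : n - k + i < n by lia.
  exists (Ordinal ltj); apply/eqP; exact: (@decode_step _ i (Ordinal ltj)).
have ltj := ltn_ord j.
have conclude (w : word (n - k).+1 k) : frozen_word w -> decode w = cyclic_interval j ->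
    frozen_word (code k S).
  move=> frw eqw; rewrite eqS -/(cyclic_interval j) -eqw.
  by rewrite decodeK ?frozen_word_weakly_incr.
have [lej|ltj'] := leqP j (n - k).
  have wc l : l < k -> letter (constant_word k (inord j : 'I_(n - k).+1)) l = j.
    by move=> ltl; rewrite letter_mkword ?inordK.
  by apply: conclude (decode_constant lej wc); apply/frozen_wordP; left; exists j.
have lti : j - (n - k) < k by lia.
have wi l : l < k -> letter (step_word (n - k) k (j - (n - k))) l =
    if l < j - (n - k) then 0 else n - k.
  by move=> ltl; rewrite letter_mkword //; case: ifP.
apply: conclude (decode_step lti _ wi); last by lia.
by apply/frozen_wordP; right; exists (j - (n - k)) => //; apply: ltnW.
Qed.

End FrozenSets.

(** * Entries of the vectors in terms of letters *)

Section VvecEntries.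
Variables (R : realType) (n k : nat).
Implicit Types S : {set 'I_n}.
Local Notation m := (n - k)%N.

(** The sum telescopes: reduction mod [m] gives the column [ordS t] as the residue of [t + 1], also
    at the wrap from the last column to the first. *)
Lemma sum_cyclic_differences a b (j : 'I_m) : (a <= b <= m)%N ->
  \sum_(t < m | (a <= t < b)%N) ((j == t)%:R - (j == ordS t)%:R) =
  (a %% m == j)%N%:R - (b %% m == j)%N%:R :> R.
Proof.
move=> /andP[leab lebm]; pose F t : R := (t %% m == j)%N%:R.
rewrite (eq_bigr (fun t : 'I_m => F t - F t.+1)); last first.
  move=> t _; rewrite /F modn_small // -!(inj_eq val_inj) /=.
  by rewrite (eq_sym (nat_of_ord t)) (eq_sym (t.+1 %% m)%N).
have -> : \sum_(t < m | (a <= t < b)%N) (F t - F t.+1) =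
    \sum_(a <= t < b) (F t - F t.+1).
  rewrite (big_nat_widenl a 0) // (big_nat_widen 0 b m) // big_mkord.
  by apply: eq_bigl => t; rewrite andbC.
by rewrite -opprB -(telescope_sumr F leab) -sumrN; apply: eq_bigr => t _; rewrite opprB.
Qed.

Lemma vvecE S (i : 'I_k.-1) (j : 'I_m) : #|S| = k ->
  vvec R k S i j = (letter (code k S) i %% m == j)%N%:R -
                   (letter (code k S) i.+1 %% m == j)%N%:R.
Proof.
move=> Sk; have lti := ltn_ord i.
have lti1 : (i.+1 < k)%N by lia.
have lei := weakly_incrP _ (code_weakly_incr Sk) i lti1.
have ltm := letter_lt (code k S) lti1.
rewrite /vvec summxE (bigD1 i) //= [X in _ + X]big1 ?addr0.
  rewrite summxE -sum_cyclic_differences; last by rewrite lei -ltnS.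
  rewrite !letter_code //; last by lia.
  by apply: eq_bigr => t _; rewrite !mxE eqxx.
move=> l nel; rewrite summxE big1 // => t _.
by rewrite !mxE eq_sym (negPf nel) /= subrr.
Qed.

Lemma vvec_frozen S : #|S| = k -> frozen_word (code k S) -> vvec R k S = 0.
Proof.
move=> Sk frS; apply/matrixP => i j; rewrite vvecE // mxE.
have lti := ltn_ord i.
case/frozen_wordP: frS => [[c _ xc]|[l _ xl]]; first by rewrite !xc ?subrr //; lia.
have md x : (x = 0 \/ x = m)%N -> (x %% m = 0)%N.
  by case=> ->; rewrite ?mod0n ?modnn.
rewrite !md ?subrr // xl; [case: ifP; auto|lia|case: ifP; auto|lia].
Qed.

End VvecEntries.

(** * Uniqueness and existence of noncrossing combinations *)

Section Representation.
Variables (R : realType) (n k : nat).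
Hypotheses (k_ge2 : (2 <= k)%N) (k_le : (k <= n - 2)%N).
Local Notation m := (n - k)%N.
Local Notation W := (word m.+1 k).

(** The mass on column [j] at position [i], the letters 0 and [m] sharing column 0; differences
    between consecutive positions are the entries of the combination. *)
Definition residue_weight (w : W -> R) (i j : nat) : R :=
  \sum_x w x * (letter x i %% m == j)%N%:R.

Lemma residue_weightE (w : W -> R) i j : (i < k)%N -> (j < m)%N ->
  residue_weight w i j =
  if j == 0%N then marginal w i 0 + marginal w i m else marginal w i j.
Proof.
move=> lti ltj; have m0 : (0 < m)%N by lia.
have lem x := letter_lt (x : W) lti.
rewrite /residue_weight /marginal.
have mulb (x : W) (b : bool) : w x * b%:R = if b then w x else 0.
  by case: b; rewrite ?mulr1 ?mulr0.
under eq_bigr do rewrite mulb.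
case: eqP => [->|/eqP j0]; last first.
  rewrite [RHS]big_mkcond; apply: eq_bigr => x _; have := lem x.
  rewrite ltnS leq_eqVlt => /orP[/eqP->|ltx]; last by rewrite modn_small.
  by rewrite modnn eq_sym (negPf j0) gtn_eqF.
rewrite [X in _ = X + _]big_mkcond [X in _ = _ + X]big_mkcond -big_split.
apply: eq_bigr => x _; have := lem x; rewrite ltnS leq_eqVlt => /orP[/eqP->|ltx].
  by rewrite modnn !eqxx gtn_eqF //= add0r.
by rewrite modn_small // (ltn_eqF ltx) /= addr0.
Qed.

Lemma sum_code (f : W -> R) : (forall x, f x != 0 -> weakly_incr x) ->
  \sum_(S : {set 'I_n} | #|S| == k) f (code k S) = \sum_x f x.
Proof.
move=> fw; have lekn : (k <= n)%N by lia.
rewrite [RHS](bigID (@weakly_incr _ _)) /= [X in _ = _ + X]big1 ?addr0; last first.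
  by move=> x; apply: contraNeq => /fw.
rewrite (reindex_onto (@code n k) (@decode n k)) /=; last first.
  by move=> x iw; rewrite decodeK.
apply: eq_bigl => S; apply/idP/andP => [/eqP Sk|[iw /eqP <-]].
  by rewrite code_weakly_incr // codeK.
by rewrite card_decode.
Qed.

(** [T] and [w] are compared only after multiplication by the vectors, which lets them differ on
    frozen sets, whose vector is zero. *)
Lemma sum_vvec_entry (T : {set 'I_n} -> R) (w : W -> R) (i : 'I_k.-1) (j : 'I_m) :
    (forall S : {set 'I_n}, T S != 0 -> #|S| = k) ->
    (forall x, w x != 0 -> weakly_incr x) ->
    (forall S : {set 'I_n}, #|S| = k -> T S *: vvec R k S = w (code k S) *: vvec R k S) ->
  (\sum_S T S *: vvec R k S) i j = residue_weight w i j - residue_weight w i.+1 j.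
Proof.
move=> Tk ww Tw; rewrite summxE (bigID (fun S : {set 'I_n} => #|S| == k)) /=.
rewrite [X in _ + X]big1 ?addr0; last first.
  move=> S neS; have -> : T S = 0 by apply/eqP; apply: contraNT neS => /Tk ->.
  by rewrite scale0r mxE.
rewrite -sumrB -sum_code; last first.
  by move=> x; rewrite -mulrBr mulf_eq0 negb_or => /andP[/ww].
by apply: eq_bigr => S /eqP Sk; rewrite Tw // mxE vvecE // -mulrBr.
Qed.

Definition noncrossing_combination (T : {set 'I_n} -> R) : Prop :=
  [/\ forall S, 0 <= T S, forall S : {set 'I_n}, T S != 0 -> #|S| = k /\ ~~ frozen k S
    & forall A B, T A != 0 -> T B != 0 -> noncrossing k A B].

Lemma noncrossing_combination_unique T T' :
    noncrossing_combination T -> noncrossing_combination T' ->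
    \sum_S T S *: vvec R k S = \sum_S T' S *: vvec R k S ->
  T =1 T'.
Proof.
have lekn : (k <= n)%N by lia.
have k0 : (0 < k)%N by lia.
have m0 : (0 < m)%N by lia.
(* Words that are not weakly increasing code no [k]-subset and get weight zero. *)
pose w (U : {set 'I_n} -> R) (x : W) := if weakly_incr x then U (decode x) else 0.
have w_code U (S : {set 'I_n}) : #|S| = k -> w U (code k S) = U S.
  by move=> Sk; rewrite /w code_weakly_incr // codeK.
have w_incr U x : w U x != 0 -> weakly_incr x by rewrite /w; case: ifP; rewrite ?eqxx.
have nc_w U : noncrossing_combination U -> noncrossing_weight (w U).
  move=> [U0 Uk Unc]; split=> [x|x|x y]; [by rewrite /w; case: ifP|exact: w_incr|].
  rewrite /w; case: ifP => [ix Ux|]; last by rewrite eqxx.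
  case: ifP => [iy Uy|]; last by rewrite eqxx.
  have := Unc _ _ Ux Uy; rewrite noncrossing_code ?card_decode // !decodeK //.
  by case/andP.
have entry U (i : 'I_k.-1) (j : 'I_m) : noncrossing_combination U ->
    (\sum_S U S *: vvec R k S) i j =
    residue_weight (w U) i j - residue_weight (w U) i.+1 j.
  move=> [U0 Uk _]; apply: sum_vvec_entry => [S /Uk[]//|x|S Sk]; first exact: w_incr.
  by rewrite w_code.
move=> ncT ncT' eqv.
have eqres i j : (i.+1 < k)%N -> (j < m)%N ->
    residue_weight (w T) i j - residue_weight (w T) i.+1 j =
    residue_weight (w T') i j - residue_weight (w T') i.+1 j.
  move=> lti ltj; have lti' : (i < k.-1)%N by lia.
  by rewrite -(entry T (Ordinal lti') (Ordinal ltj)) // eqv entry.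
have eqw : forall x, ~~ frozen_word x -> w T x = w T' x.
  apply: noncrossing_weight_unique_mod_frozen => //; [exact: nc_w|exact: nc_w| |].
    move=> i c lti ltc; have := eqres i c lti; rewrite !residue_weightE; [|lia..].
    by rewrite (gtn_eqF (andP ltc).1) => -> //; lia.
  by move=> i lti; have := eqres i 0%N lti m0; rewrite !residue_weightE //; lia.
have half U U' (S : {set 'I_n}) : noncrossing_combination U ->
    (forall x, ~~ frozen_word x -> w U x = w U' x) -> U S != 0 -> U S = U' S.
  move=> [_ Uk _] eqU /Uk[Sk nfS]; rewrite -w_code // eqU ?w_code //.
  by rewrite -frozen_code.
move=> S; have [T0|/half] := eqVneq (T S) 0; last by apply.
have [T'0|T'S] := eqVneq (T' S) 0; first by rewrite T0 T'0.
by rewrite (half T' T S) // => x /eqw.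
Qed.

Lemma ler_sum_subset (I : finType) (Q : pred I) (f : I -> R) :
  (forall i, 0 <= f i) -> \sum_(i | Q i) f i <= \sum_i f i.
Proof.
by move=> f0; rewrite big_mkcond ler_sum // => i _; case: ifP.
Qed.

Lemma ler_norm_sum_subset (I : finType) (Q : pred I) (f : I -> R) :
  `|\sum_(i | Q i) f i| <= \sum_i `|f i|.
Proof. by apply: le_trans (ler_norm_sum _ _ _) _; apply: ler_sum_subset. Qed.

(** * Lifting a vector to increasing marginals *)

Section Existence.
Variable v : 'M[R]_(k.-1, m).
Hypothesis Hv : Hspace v.

Definition entry_bound : R := \sum_i \sum_j `|v i j|.
Local Notation B := entry_bound.

Definition column_sum (i c : nat) : R :=
  \sum_(l < k.-1 | (l < i)%N) \sum_(j < m | j == c :> nat) v l j.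

(* Lowering every row by the partial sums of v realises v as the differences of
   consecutive rows; moving a mass B from the letter 0 to the letter m in each
   row then makes the rows stochastically increasing. *)
Definition target_marginal (i : nat) (c : 'I_m.+1) : R :=
  if c == m :> nat then i%:R * B
  else k.+1%:R * B - column_sum i c - (if c == 0%N :> nat then i%:R * B else 0).

Lemma entry_bound_ge0 : 0 <= B.
Proof. by apply: sumr_ge0 => i _; apply: sumr_ge0. Qed.

Lemma column_sum_bound i c : `|column_sum i c| <= B.
Proof.
apply: le_trans (ler_norm_sum_subset _ _) _.
by apply: ler_sum => l _; apply: ler_norm_sum_subset.
Qed.

Lemma column_sumS i c : (i.+1 < k)%N ->
  exists2 l : 'I_k.-1, l = i :> nat &
    column_sum i.+1 c = column_sum i c + \sum_(j < m | j == c :> nat) v l j.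
Proof.
move=> lti; have lti' : (i < k.-1)%N by lia.
exists (Ordinal lti') => //; rewrite /column_sum (bigD1 (Ordinal lti')) //= addrC.
congr (_ + _); apply: eq_bigl => l; rewrite -(inj_eq val_inj) /= ltnS.
by rewrite ltn_neqAle andbC.
Qed.

Lemma sum_column_sum i : \sum_(c < m) column_sum i c = 0.
Proof.
rewrite /column_sum exchange_big big1 //= => l _.
rewrite -[RHS](Hv l); apply: eq_bigr => c _.
by rewrite (big_pred1 c).
Qed.

Lemma target_marginal_ge0 i c : (i < k)%N -> 0 <= target_marginal i c.
Proof.
move=> lti; have B0 := entry_bound_ge0; have i0 : 0 <= i%:R * B by rewrite mulr_ge0.
rewrite /target_marginal; case: ifP => // _.
(* The [k + 1] copies of [B] cover the [i < k] copies moved away from the letter 0 and the one that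
   bounds the column sum. *)
have le_i : i.+2%:R * B <= k.+1%:R * B by rewrite ler_wpM2r // ler_nat.
have := column_sum_bound i c; rewrite ler_norml => /andP[_ leB].
have : i.+2%:R * B = i%:R * B + B + B by rewrite -!natr1 !mulrDl !mul1r.
by case: ifP => _; lra.
Qed.

(** The column sums cancel because the rows of [v] sum to zero, and the mass taken from the letter 0
    reappears at [m]. *)
Lemma sum_target_marginal i : \sum_c target_marginal i c = m%:R * (k.+1%:R * B).
Proof.
have m0 : (0 < m)%N by lia.
rewrite big_ord_recr /= {2}/target_marginal /= eqxx.
have -> : \sum_(c < m) target_marginal i (widen_ord (leqnSn m) c) =
    \sum_(c < m) (k.+1%:R * B - column_sum i c -
      (if c == Ordinal m0 then i%:R * B else 0)).
  by apply: eq_bigr => c _; rewrite /target_marginal /= ltn_eqF.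
rewrite sumrB (sumr_point xpredT) /= subrK sumrB sum_column_sum subr0.
by rewrite sumr_const card_ord [RHS]mulr_natl.
Qed.

(** For [c < m] the two cumulative sums differ by a partial sum of row [i] of [v], plus the extra
    [B] that leaves the letter 0; [B] bounds that partial sum. For [c >= m] both are the total. *)
Lemma target_marginal_dominates (i c : nat) : (i.+1 < k)%N ->
  \sum_(y : 'I_m.+1 | (y <= c)%N) target_marginal i.+1 y <=
  \sum_(y : 'I_m.+1 | (y <= c)%N) target_marginal i y.
Proof.
move=> lti; have m0 : (0 < m)%N by lia.
have [lemc|ltcm] := leqP m c.
  have all_y (y : 'I_m.+1) : (y <= c)%N = true.
    by apply: leq_trans lemc; rewrite -ltnS.
  by rewrite !(eq_bigl _ _ all_y) !sum_target_marginal.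
rewrite -subr_ge0 -sumrB.
have lti' : (i < k.-1)%N by lia.
pose l := Ordinal lti'.
have -> : \sum_(y : 'I_m.+1 | (y <= c)%N) (target_marginal i y - target_marginal i.+1 y)
  = \sum_(y : 'I_m.+1 | (y <= c)%N) \sum_(j < m | j == y :> nat) v l j + B.
  rewrite -[B in RHS](sumr_point (fun y : 'I_m.+1 => (y <= c)%N) ord0 B) /= -big_split.
  apply: eq_bigr => y ley; rewrite /target_marginal ltn_eqF; last by lia.
  have [l' eql ->] := column_sumS y lti.
  have -> : l' = l by apply/val_inj.
  rewrite -(inj_eq val_inj) /= -natr1.
  by case: eqP => _; ring.
rewrite (exchange_big_dep (fun j : 'I_m => (j <= c)%N)) /=; last by move=> y j ley /eqP->.
suff : `|\sum_(j < m | (j <= c)%N) v l j| <= B.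
  rewrite ler_norml => /andP[geB _].
  rewrite (eq_bigr (fun j => v l j)) => [|j lej]; first by lra.
  rewrite (big_pred1 (widen_ord (leqnSn m) j)) // => y.
  rewrite -[RHS](inj_eq val_inj) /= eq_sym.
  by case: eqP => [->|]; rewrite ?lej ?andbF.
apply: le_trans (ler_norm_sum_subset _ _) _.
rewrite /B (bigD1 l) //= lerDl.
by apply: sumr_ge0 => i' _; apply: sumr_ge0.
Qed.

Lemma noncrossing_combination_exists :
  exists2 T, noncrossing_combination T & v = \sum_S T S *: vvec R k S.
Proof.
have m0 : (0 < m)%N by lia.
have k0 : (0 < k)%N by lia.
have lekn : (k <= n)%N by lia.
have [||||w [[w0 wi wu] _ wm]] :=
  @noncrossing_weight_exists _ _ target_marginal (m%:R * (k.+1%:R * B)) k.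
- by rewrite !mulr_ge0 ?entry_bound_ge0.
- by move=> i c; apply: target_marginal_ge0.
- by move=> i _; apply: sum_target_marginal.
- exact: target_marginal_dominates.
pose T (S : {set 'I_n}) := if (#|S| == k) && ~~ frozen k S then w (code k S) else 0.
have TE S : T S != 0 -> [/\ #|S| = k, ~~ frozen k S & w (code k S) != 0].
  by rewrite /T; case: ifP => [/andP[/eqP-> ->]|]; rewrite ?eqxx.
exists T; first split.
- by move=> S; rewrite /T; case: ifP.
- by move=> S /TE[].
- move=> A B /TE[Ak _ wA] /TE[Bk _ wB].
  by rewrite noncrossing_code // !wu.
apply/matrixP => i j; have lti := ltn_ord i; have ltj := ltn_ord j.
rewrite (sum_vvec_entry i j (w := w)) //; first last.
- move=> S Sk; rewrite /T Sk eqxx /=; case: ifP => // /negbT; rewrite negbK.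
  by rewrite frozen_code // => /vvec_frozen->; rewrite ?scaler0.
- by move=> S /TE[].
have lti1 : (i.+1 < k)%N by lia.
have tm (c : nat) i' : (i' < k)%N -> (c <= m)%N -> exists2 y : 'I_m.+1, y = c :> nat &
    marginal w i' c = target_marginal i' y.
  by move=> lti' lec; exists (Ordinal (lec : (c < m.+1)%N)) => //; rewrite -wm.
have colS c : (c < m)%N -> c = j -> column_sum i.+1 c = column_sum i c + v i j.
  move=> ltc eqc; have [l eql ->] := column_sumS c lti1.
  have -> : l = i by apply/val_inj.
  by rewrite (big_pred1 j) // => j'; rewrite eqc.
have lti0 : (i < k)%N by lia.
have tmj i' : (i' < k)%N -> marginal w i' j = k.+1%:R * B - column_sum i' j -
     (if j == 0%N :> nat then i'%:R * B else 0).
  move=> lti'; have [y eqy ->] := tm j i' lti' (ltnW ltj).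
  by rewrite /target_marginal eqy ltn_eqF.
have tmm i' : (i' < k)%N -> marginal w i' m = i'%:R * B.
  move=> lti'; have [y eqy ->] := tm m i' lti' (leqnn m).
  by rewrite /target_marginal eqy eqxx.
have colj := colS j ltj erefl.
(* Column 0 collects the letters 0 and [m], so the mass [i B] moved between them cancels. *)
rewrite !residue_weightE //; case: eqP => [j0|/eqP j0].
  have := tmj i lti0; have := tmj i.+1 lti1.
  rewrite !tmm // colj !j0 eqxx -natr1 => -> ->; ring.
by rewrite !tmj // colj (negPf j0); ring.
Qed.

End Existence.
End Representation.

(** * Fans from unique representations *)

Section FanFromUniqueRepresentation.
Variables (R : realType) (r c : nat).
Local Notation V := 'M[R]_(r, c).

Lemma mx_ballP (x y : V) (e : R) : 0 < e ->
  ball x e y <-> forall i j, `|x i j - y i j| < e.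
Proof. by move=> e0; split=> [[_ h] i j|h]; [exact: h|split=> // i j; apply: h]. Qed.

Lemma near_scalar_gt0 (u : {scalar V}) (x : V) : 0 < u x -> \forall y \near x, 0 < u y.
Proof.
(* [K - 1] bounds [u] in the sup norm of the entries; the added 1 makes [K] positive and the final
   inequality strict. *)
move=> ux; pose K := 1 + \sum_i \sum_j `|u (delta_mx i j)|.
have K0 : 0 < K by rewrite ltr_pwDl //; do 2!apply: sumr_ge0 => ? _.
have uK0 : 0 < u x / K by rewrite divr_gt0.
apply/nbhs_ballP; exists (u x / K) => //= y /(mx_ballP _ _ uK0) xy.
rewrite -[y](subrKC x) linearD /=.
suff : `|u (y - x)| < u x by rewrite ltr_norml; lra.
rewrite [y - x]matrix_sum_delta linear_sum /=.
apply: le_lt_trans (ler_norm_sum _ _ _) _.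
apply: (@le_lt_trans _ _ (u x / K * (K - 1))); last first.
  by rewrite mulrBr mulr1 divfK ?gt_eqF // gtrBl divr_gt0.
have -> : K - 1 = \sum_i \sum_j `|u (delta_mx i j)| by rewrite /K addrC addKr.
rewrite mulr_sumr; apply: ler_sum => i _.
rewrite linear_sum mulr_sumr; apply: le_trans (ler_norm_sum _ _ _) _.
apply: ler_sum => j _; rewrite linearZ /= normrM ler_wpM2r // !mxE distrC.
exact/ltW/xy.
Qed.

Lemma near_subtract_ray (x g : V) (A : set V) : (\forall y \near x, A y) ->
  exists2 e : R, 0 < e & A (x - e *: g).
Proof.
move=> /nbhs_ballP[d /= d0 dA]; pose K := 1 + \sum_i \sum_j `|g i j|.
have gK i j : `|g i j| < K.
  rewrite ltr_pwDl // (bigD1 i) //= (bigD1 j) //= -addrA lerDl.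
  by rewrite addr_ge0 // sumr_ge0 // => i' _; apply: sumr_ge0.
have K0 : 0 < K by rewrite ltr_pwDl //; do 2!apply: sumr_ge0 => ? _.
exists (d / K); first exact: divr_gt0.
apply/dA/mx_ballP => // i j; rewrite !mxE opprB addrC subrK normrM.
rewrite gtr0_norm ?divr_gt0 // -[ltRHS](divfK (lt0r_neq0 K0)).
by rewrite ltr_pM2l ?divr_gt0.
Qed.

Variables (I : finType) (g : I -> V).
Implicit Types (J K : {set I}) (T : I -> R).

Definition support T : {set I} := [set S | T S != 0]%SET.

Lemma notin_support T J S : support T \subset J -> S \notin J -> T S = 0.
Proof.
move=> /fintype.subsetP sTJ; apply: contraNeq => TS; apply: sTJ.
by rewrite finset.inE.
Qed.

Lemma supportS T J : (forall S, S \notin J -> T S = 0) -> support T \subset J.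
Proof.
move=> T0; apply/fintype.subsetP => S; rewrite finset.inE.
by apply: contraR => /T0 ->.
Qed.

Lemma sum_support T J : support T \subset J ->
  \sum_S T S *: g S = \sum_(S in J) T S *: g S.
Proof.
move=> sTJ; rewrite [LHS](bigID (mem J)) /= [X in _ + X]big1 ?addr0 // => S nJ.
by rewrite (notin_support sTJ) ?scale0r.
Qed.

Lemma coneP J x : cone J g x <->
  exists T, [/\ forall S, 0 <= T S, support T \subset J & x = \sum_S T S *: g S].
Proof.
split=> [[t t0 ->]|[T [T0 sTJ ->]]]; last first.
  by exists T => [S _|]; rewrite ?(sum_support sTJ).
exists (fun S => if S \in J then t S else 0); split.
- by move=> S; case: ifP => // /t0.
- by apply: supportS => S /negPf->.
- rewrite [RHS](bigID (mem J)) /= [X in _ + X]big1 ?addr0.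
    by apply: eq_bigr => S ->.
  by move=> S /negPf->; rewrite scale0r.
Qed.

Lemma cone_gen J S : S \in J -> cone J g (g S).
Proof.
move=> SJ; apply/coneP; exists (fun S' => (S' == S)%:R); split.
- by move=> S'; rewrite ler0n.
- by apply: supportS => S'; case: eqP => // ->; rewrite SJ.
- rewrite (bigD1 S) //= eqxx scale1r big1 ?addr0 // => S' /negPf->.
  by rewrite scale0r.
Qed.

Lemma sub_cone J K : K \subset J -> (cone K g `<=` cone J g)%classic.
Proof.
move=> sKJ x /coneP[T [T0 sT ->]]; apply/coneP; exists T; split=> //.
exact: fintype.subset_trans sT sKJ.
Qed.

(** Packaged as a linear form because [face] asks for a [{scalar V}]. *)
Definition sum_scalar (n : nat) (Q : pred 'I_n) (f : 'I_n -> {scalar V}) (x : V) : R :=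
  \sum_(i | Q i) f i x.

Fact sum_scalar_is_linear n Q f : scalar (@sum_scalar n Q f).
Proof.
move=> a x y; rewrite /sum_scalar mulr_sumr -big_split /=.
by apply: eq_bigr => i _; rewrite linearP.
Qed.

HB.instance Definition _ n Q f :=
  GRing.isLinear.Build R V R _ (@sum_scalar n Q f) (@sum_scalar_is_linear n Q f).

(** * Subset-closed families with unique nonnegative representations *)

Variable Fam : {set {set I}}.
Hypothesis Fam0 : finset.set0 \in Fam.
Hypothesis FamS : forall J K, J \in Fam -> K \subset J -> K \in Fam.
Hypothesis repr_unique : forall T T',
  (forall S, 0 <= T S) -> (forall S, 0 <= T' S) ->
  support T \in Fam -> support T' \in Fam ->
  \sum_S T S *: g S = \sum_S T' S *: g S -> T =1 T'.

(** The positive and negative parts of a linear relation are two nonnegative representations of one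
    vector, both supported in [J]; by uniqueness they are equal. *)
Lemma Fam_independent J T : J \in Fam -> support T \subset J ->
  \sum_S T S *: g S = 0 -> forall S, T S = 0.
Proof.
move=> JF sTJ T0.
pose P S := Num.max (T S) 0; pose N S := Num.max (- T S) 0.
have P0 S : 0 <= P S by rewrite le_max lexx orbT.
have N0 S : 0 <= N S by rewrite le_max lexx orbT.
have PN S : T S = P S - N S.
  by rewrite /P /N; case: (leP (T S) 0); case: (leP (- T S) 0); lra.
have sP : support P \subset J.
  by apply: supportS => S nJ; rewrite /P (notin_support sTJ) ?maxxx.
have sN : support N \subset J.
  by apply: supportS => S nJ; rewrite /N (notin_support sTJ) ?oppr0 ?maxxx.
have eqPN : P =1 N.
  apply: repr_unique => //; [exact: FamS sP|exact: FamS sN|].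
  apply/eqP; rewrite -subr_eq0 -sumrB -[X in _ == X]T0; apply/eqP.
  by apply: eq_bigr => S _; rewrite -scalerBl -PN.
by move=> S; rewrite PN eqPN subrr.
Qed.

Definition gen_tuple J : #|J|.-tuple V := [tuple g (enum_val i) | i < #|J|].

Lemma gen_tupleE J (i : 'I_#|J|) : (gen_tuple J)`_i = g (enum_val i).
Proof. by rewrite -tnth_nth tnth_mktuple. Qed.

Lemma gen_tuple_free J : J \in Fam -> free (gen_tuple J).
Proof.
move=> JF; apply/freeP => a suma.
pose T S := \sum_(i < #|J| | enum_val i == S) a i.
have TE i : T (enum_val i) = a i.
  by rewrite /T (big_pred1 i) // => i'; rewrite /= (inj_eq enum_val_inj).
have sT : support T \subset J.
  apply: supportS => S nJ; rewrite /T big_pred0 // => i.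
  by apply/eqP => eqS; rewrite -eqS enum_valP in nJ.
have sumT : \sum_S T S *: g S = 0.
  rewrite (sum_support sT) big_enum_val -[RHS]suma.
  by apply: eq_bigr => i _; rewrite TE gen_tupleE.
by move=> i; rewrite -TE (Fam_independent JF sT sumT).
Qed.

(** The supporting functional of the face spanned by [K]: the sum of the coordinates along the
    generators of [J] outside [K]. With [K] the complement of one element of [J] it is a single
    coordinate. *)
Definition outside_coord J K : {scalar V} :=
  sum_scalar (fun i : 'I_#|J| => enum_val i \notin K) (coord (gen_tuple J)).

Lemma outside_coord_gen J K S : J \in Fam -> S \in J ->
  outside_coord J K (g S) = (S \notin K)%:R.
Proof.
move=> JF SJ; rewrite /outside_coord /= /sum_scalar.
rewrite -(enum_rankK_in SJ SJ); set i0 := enum_rank_in _ _.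
rewrite -gen_tupleE.
rewrite (eq_bigr (fun i => if i == i0 then 1 else 0)) => [|i _]; last first.
  transitivity ((i0 == i)%:R : R); last by rewrite eq_sym; case: eqP.
  exact: (coord_free i0 i (gen_tuple_free JF)).
by rewrite sumr_point; case: (_ \notin _).
Qed.

Lemma outside_coord_sum J K T : J \in Fam -> support T \subset J ->
  outside_coord J K (\sum_S T S *: g S) = \sum_(S in J) T S * (S \notin K)%:R.
Proof.
move=> JF sT; rewrite (sum_support sT) linear_sum; apply: eq_bigr => S SJ.
by rewrite linearZ /= outside_coord_gen.
Qed.

(** If the coefficient at [S] were zero at an interior point [x], some [x - e *: g S] would stay in
    the cone, and adding [e *: g S] back would represent [x] with a positive coefficient at [S].
    Conversely, positive coordinates stay positive nearby, and a point of the affine hull has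
    coefficients supported in [J], which these coordinates read off. *)
Lemma relative_interiorP J x : J \in Fam ->
  relative_interior (cone J g) x <->
  exists T, [/\ forall S, 0 <= T S, support T = J & x = \sum_S T S *: g S].
Proof.
move=> JF; split=> [[/coneP[T [T0 sT eqx]] nearx]|[T [T0 sT eqx]]].
  exists T; split=> //; apply/eqP; rewrite finset.eqEsubset sT /=.
  apply/fintype.subsetP => S SJ; rewrite finset.inE; apply/eqP => TS.
  have [e e0 affC] := near_subtract_ray (g S) nearx.
  have /coneP[T' [T'0 sT' eqx']] : cone J g (x - e *: g S).
    apply: affC; exists 2, (fun i => if i == ord0 then x else x + g S).
    exists (fun i => if i == ord0 then 1 + e else - e); split.
    - move=> i; case: ifP => _; apply/coneP.
        by exists T; split.
      exists (fun S' => T S' + (S' == S)%:R); split.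
      + by move=> S'; rewrite addr_ge0 ?ler0n.
      + apply: supportS => S' nJ; rewrite (notin_support sT) // add0r.
        by case: eqP nJ => // ->; rewrite SJ.
      + rewrite eqx; under [RHS]eq_bigr do rewrite scalerDl.
        rewrite big_split /=; congr (_ + _).
        rewrite (bigD1 S) //= eqxx scale1r big1 ?addr0 // => S' /negPf->.
        by rewrite scale0r.
    - by rewrite !big_ord_recl big_ord0 /=; ring.
    - rewrite !big_ord_recl big_ord0 /= addr0 scalerDl scale1r scaleNr scalerDr.
      by rewrite opprD addrA addrK.
  have /(_ S) : T =1 (fun S' => T' S' + (if S' == S then e else 0)).
    apply: repr_unique => //.
    - by move=> S'; rewrite addr_ge0 //; case: ifP => // _; apply: ltW.
    - exact: FamS sT.
    - apply: FamS JF _; apply: supportS => S' nJ; rewrite (notin_support sT') // add0r.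
      by case: eqP nJ => // ->; rewrite SJ.
    - under [RHS]eq_bigr do rewrite scalerDl.
      rewrite big_split /= -eqx' -eqx (bigD1 S) //= eqxx big1.
        by rewrite addr0 subrK.
      by move=> S' /negPf->; rewrite scale0r.
  rewrite TS eqxx => /esym/eqP; rewrite gt_eqF //.
  by rewrite ltr_wpDl.
have sTJ : support T \subset J by rewrite sT.
split; first by apply/coneP; exists T.
have coord1 S : S \in J -> 0 < outside_coord J [set~ S]%SET x.
  move=> SJ; rewrite eqx outside_coord_sum // (bigD1 S) //= !finset.inE eqxx mulr1.
  rewrite ltr_pwDl ?sumr_ge0 // => [|S' _]; last by rewrite mulr_ge0 ?ler0n.
  by rewrite lt0r T0 andbT; move: SJ; rewrite -sT finset.inE.
have : \forall y \near x, forall S, S \in J -> 0 < outside_coord J [set~ S]%SET y.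
  apply: (@filter_forall V I
    (fun S y => S \in J -> 0 < outside_coord J [set~ S]%SET y) (nbhs x)) => S.
  have [SJ|nSJ] := boolP (S \in J); last by near=> y.
  by have := near_scalar_gt0 (coord1 S SJ); apply: filterS => y.
apply: filterS => y ypos [h [f [a [fC suma eqy]]]].
have [Tf Tf_spec] := choice (fun i => (coneP J (f i)).1 (fC i)).
pose U S := \sum_i a i * Tf i S.
have sU : support U \subset J.
  apply: supportS => S nJ; rewrite /U big1 // => i _.
  by have [_ sTi _] := Tf_spec i; rewrite (notin_support sTi) ?mulr0.
have eqyU : y = \sum_S U S *: g S.
  rewrite eqy; under [RHS]eq_bigr do rewrite scaler_suml.
  rewrite exchange_big /=; apply: eq_bigr => i _.
  have [_ _ ->] := Tf_spec i; rewrite scaler_sumr.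
  by apply: eq_bigr => S _; rewrite scalerA.
apply/coneP; exists U; split=> // S.
have [SJ|nSJ] := boolP (S \in J); last by rewrite (notin_support sU).
have := ypos S SJ; rewrite eqyU outside_coord_sum // (bigD1 S) //= !finset.inE eqxx mulr1.
rewrite big1 ?addr0; first exact: ltW.
by move=> S' /andP[_ neS]; rewrite !finset.inE neS mulr0.
Unshelve. all: by end_near.
Qed.

(** A vanishing sum of nonnegative terms [T S * u (g S)] vanishes termwise, so only the generators
    killed by [u] contribute to the face. *)
Lemma face_cone J (F : set V) : face F (cone J g) ->
  exists2 K : {set I}, K \subset J & F = cone K g.
Proof.
move=> [u [u0 ->]]; exists [set S in J | u (g S) == 0]%SET.
  by apply/fintype.subsetP => S; rewrite finset.inE => /andP[].
apply/seteqP; split=> x /=.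
  move=> [/coneP[T [T0 sT eqx]] ux0]; apply/coneP; exists T; split=> //.
  have ug S : S \in J -> 0 <= u (g S) by move=> /cone_gen/u0.
  have : \sum_(S in J) T S * u (g S) = 0.
    rewrite -[RHS]ux0 eqx (sum_support sT) linear_sum.
    by apply: eq_bigr => S _; rewrite linearZ.
  move=> /psumr_eq0P => eq0; apply/fintype.subsetP => S SS.
  have SJ := fintype.subsetP sT _ SS; rewrite finset.inE SJ /=.
  have := eq0 (fun S' SJ' => mulr_ge0 (T0 S') (ug S' SJ')) S SJ.
  move=> /eqP; rewrite mulf_eq0; case/orP => //.
  by move: SS; rewrite finset.inE => /negPf->.
set K := [set S in J | _]%SET => xK; have sKJ : K \subset J.
  by apply/fintype.subsetP => S; rewrite finset.inE => /andP[].
split; first exact: (sub_cone sKJ).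
have /coneP[T [T0 sT ->]] := xK; rewrite (sum_support sT) linear_sum big1 // => S.
by rewrite finset.inE => /andP[_ /eqP ug0]; rewrite linearZ /= ug0 mulr0.
Qed.

Lemma cone_face J K : J \in Fam -> K \subset J -> face (cone K g) (cone J g).
Proof.
move=> JF sKJ; exists (outside_coord J K); split=> [x /coneP[T [T0 sT ->]]|].
  by rewrite outside_coord_sum // sumr_ge0 // => S _; rewrite mulr_ge0 ?ler0n.
apply/seteqP; split=> x /=.
  move=> xK; split; first exact: (sub_cone sKJ).
  have /coneP[T [T0 sT ->]] := xK.
  rewrite outside_coord_sum ?(fintype.subset_trans sT) // big1 // => S _.
  have [SK|nSK] := boolP (S \in K); first by rewrite mulr0.
  by rewrite (notin_support sT) ?mul0r.
move=> [/coneP[T [T0 sT eqx]]]; rewrite eqx outside_coord_sum // => /psumr_eq0P eq0.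
apply/coneP; exists T; split=> //; apply/fintype.subsetP => S SS.
have SJ := fintype.subsetP sT _ SS; apply: contraT => nSK.
have nonneg S' : S' \in J -> 0 <= T S' * (S' \notin K)%:R.
  by rewrite mulr_ge0 ?ler0n.
have := eq0 nonneg S SJ; rewrite nSK mulr1 => TS.
by rewrite finset.inE TS eqxx in SS.
Qed.

(** A common point has a single representation, whose support lies in both index sets. *)
Lemma cone_setI J K : J \in Fam -> K \in Fam ->
  (cone J g `&` cone K g)%classic = cone (J :&: K)%SET g.
Proof.
move=> JF KF; apply/seteqP; split=> x /=; last first.
  by move=> xJK; split; apply: sub_cone xJK; [exact: subsetIl|exact: subsetIr].
move=> [/coneP[T [T0 sT eqx]] /coneP[T' [T'0 sT' eqx']]].
have TT' : T =1 T'.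
  by apply: repr_unique => //; [exact: FamS sT|exact: FamS sT'|rewrite -eqx -eqx'].
apply/coneP; exists T; split=> //; rewrite finset.subsetI sT /=.
by apply: supportS => S nK; rewrite TT' (notin_support sT').
Qed.

Lemma simplicial_cone_Fam J : J \in Fam -> simplicial_cone (cone J g).
Proof.
move=> JF; exists #|J|, (gen_tuple J); split; first exact: gen_tuple_free.
apply/seteqP; split=> x /= [t t0 ->].
  exists (fun i => t (enum_val i)) => [i _|]; first by apply: t0; apply: enum_valP.
  rewrite big_enum_val; apply: eq_big => [i|i _]; first by rewrite finset.inE.
  by rewrite tnth_mktuple.
pose T S := \sum_(i < #|J| | enum_val i == S) t i.
have TE i : T (enum_val i) = t i.
  by rewrite /T (big_pred1 i) // => i'; rewrite /= (inj_eq enum_val_inj).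
exists T => [S _|]; first by apply: sumr_ge0 => i _; apply: t0; rewrite finset.inE.
rewrite [RHS]big_enum_val; apply: eq_big => [i|i _]; first by rewrite finset.inE.
by rewrite TE tnth_mktuple.
Qed.

Variable H : set V.
Hypothesis repr_exists : forall v, H v -> exists T,
  [/\ forall S, 0 <= T S, support T \in Fam & v = \sum_S T S *: g S].
Hypothesis H_repr : forall T, support T \in Fam -> H (\sum_S T S *: g S).

(** By [relative_interiorP], [J] has to be the support of the unique representation of [v]. *)
Lemma unique_relative_interior v : H v ->
  exists! J, J \in Fam /\ relative_interior (cone J g) v.
Proof.
move=> /repr_exists[T [T0 TF eqv]]; exists (support T); split.
  by split=> //; apply/relative_interiorP => //; exists T.
move=> J [JF /(relative_interiorP _ JF)[T' [T'0 sT' eqv']]].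
have TT' : T =1 T' by apply: repr_unique => //; rewrite ?sT' // -eqv.
by rewrite -sT'; apply/finset.setP => S; rewrite !finset.inE TT'.
Qed.

Lemma complete_simplicial_fan_Fam :
  complete_simplicial_fan H
    [set C | exists2 J, J \in Fam & C = cone J g]%classic.
Proof.
have simp J := @simplicial_cone_Fam J; split.
- split.
  + split; last by exists (cone finset.set0 g), finset.set0.
    apply: (@sub_finite_set _ _ ((fun J => cone J g) @` setT)%classic).
      by move=> C [J _ ->]; exists J.
    exact/finite_image/finite_finset.
  + by move=> C [J JF ->]; have [h [X [_ ->]]] := simp J JF; exists h, (tnth X).
  + move=> C F [J JF ->] /face_cone[K sKJ ->]; exists K => //; exact: FamS sKJ.
  + move=> C D [J JF ->] [K KF ->]; rewrite cone_setI //.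
    by split; apply: cone_face => //; [exact: subsetIl|exact: subsetIr].
- by move=> C [J JF ->]; apply: simp.
- apply/seteqP.
  split=> [x [C [J JF ->] /coneP[T [_ sT ->]]]|v /repr_exists[T [T0 TF ->]]].
    by apply: H_repr; apply: FamS sT.
  by exists (cone (support T) g); [exists (support T)|apply/coneP; exists T].
Qed.

End FanFromUniqueRepresentation.

(** * Noncrossing collections as a subset-closed family *)

Section NoncrossingCollections.
Variables (R : realType) (n k : nat).
Implicit Types (J K : {set {set 'I_n}}) (T : {set 'I_n} -> R).

Lemma NCP J :
  reflect ((forall A, A \in J -> #|A| = k /\ ~~ frozen k A) /\
           (forall A B, A \in J -> B \in J -> noncrossing k A B))
          (J \in NC n k).
Proof.
rewrite finset.inE; apply: (iffP andP) => [[/forall_inP Jk /forall_inP Jnc]|[Jk Jnc]].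
  split=> [A /Jk/andP[/eqP]//|A B AJ BJ].
  by have /forall_inP := Jnc A AJ; apply.
split; apply/forall_inP => A AJ; first by have [-> ->] := Jk A AJ; rewrite eqxx.
by apply/forall_inP => B BJ; apply: Jnc.
Qed.

Lemma NC_subset J K : J \in NC n k -> K \subset J -> K \in NC n k.
Proof.
move=> /NCP[Jk Jnc] /fintype.subsetP sKJ; apply/NCP; split=> [A /sKJ/Jk//|A B].
by move=> /sKJ AJ /sKJ BJ; apply: Jnc.
Qed.

Lemma NC_support T : (forall S, 0 <= T S) ->
  support T \in NC n k <-> noncrossing_combination k T.
Proof.
move=> T0; split=> [/NCP[Tk Tnc]|[_ Tk Tnc]].
  split=> // [S TS|A B TA TB]; first by apply: Tk; rewrite finset.inE.
  by apply: Tnc; rewrite finset.inE.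
by apply/NCP; split=> [A|A B]; rewrite !finset.inE; [apply: Tk|apply: Tnc].
Qed.

Lemma Hspace_vvec (S : {set 'I_n}) : Hspace (vvec R k S).
Proof.
move=> i; under eq_bigr do rewrite /vvec summxE.
rewrite exchange_big big1 //= => l _.
under eq_bigr do rewrite summxE.
rewrite exchange_big big1 //= => t _.
have delta_sum u : \sum_j (delta_mx l u : 'M[R]_(k.-1, n - k)) i j = (i == l)%:R.
  rewrite (bigD1 u) //= mxE eqxx andbT big1 ?addr0 // => j /negPf neu.
  by rewrite mxE neu andbF.
transitivity (\sum_j ((delta_mx l t : 'M[R]_(k.-1, n - k)) i j -
                      delta_mx l (ordS t) i j)).
  by apply: eq_bigr => j _; rewrite !mxE.
by rewrite sumrB !delta_sum subrr.
Qed.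

Lemma Hspace_combination T : Hspace (\sum_S T S *: vvec R k S).
Proof.
move=> i; under eq_bigr do rewrite summxE.
rewrite exchange_big big1 //= => S _; under eq_bigr do rewrite mxE.
by rewrite -mulr_sumr (Hspace_vvec S i) mulr0.
Qed.

End NoncrossingCollections.

Local Open Scope classical_set_scope.
Local Open Scope ring_scope.

Theorem mainTheorem4 (R : realType) (k n : nat)
    (k_ge2 : (2 <= k)%N) (k_le : (k <= n - 2)%N) :
  (forall v : 'M[R]_(k.-1, n - k), Hspace v ->
     exists! J : {set {set 'I_n}},
       J \in NC n k /\ relative_interior (NCcone R k J) v) /\
  complete_simplicial_fan (@Hspace R k n)
    [set C | exists2 J : {set {set 'I_n}}, J \in NC n k & C = NCcone R k J].
Proof.
have unique (T T' : {set 'I_n} -> R) : (forall S, 0 <= T S) -> (forall S, 0 <= T' S) ->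
    support T \in NC n k -> support T' \in NC n k ->
    \sum_S T S *: vvec R k S = \sum_S T' S *: vvec R k S -> T =1 T'.
  move=> T0 T'0 /(NC_support _ T0) ncT /(NC_support _ T'0) ncT'.
  exact: noncrossing_combination_unique.
have exist (v : 'M[R]_(k.-1, n - k)) : Hspace v -> exists T : {set 'I_n} -> R,
    [/\ forall S, 0 <= T S, support T \in NC n k & v = \sum_S T S *: vvec R k S].
  move=> /(noncrossing_combination_exists k_ge2 k_le)[T ncT eqv].
  have [T0 _ _] := ncT; exists T; split=> //.
  exact/NC_support.
have NC0 : finset.set0 \in NC n k by apply/NCP; split=> A; rewrite finset.inE.
split; first exact: (unique_relative_interior (@NC_subset n k) unique exist).
apply: (complete_simplicial_fan_Fam NC0 (@NC_subset n k) unique exist) => T _.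
exact: Hspace_combination.
Qed.
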